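(* Let $\alpha\in(1,2)$ and $r\in(\alpha,2]$. Let $\vartheta$ be a symmetric $\alpha$-stable random variable, and let $(V_n)_{n\ge 1}$ be a sequence of integrable, independent, identically distributed real random variables such that $V_1$ is in the strong domain of attraction of $\vartheta$ with an attraction index $\gamma_\alpha>r-\alpha$. Set $$\tilde S_n := n^{-1/\alpha}\sum_{k=1}^n \left(V_k-\mathbb{E}[V_k]\right).$$ Then there exists a constant $C>0$ (not depending on $n$) such that for all $n\ge 1$ $$\zeta_r(\tilde S_n,\vartheta)\le C\, n^{\frac{\alpha-r}{\alpha}}.$$
   Context: Symmetric $\alpha$-stable random variable: $\vartheta$ is symmetric $\alpha$-stable with tail parameter $c>0$ if $\mathbb{E}[e^{iu\vartheta}]=\exp\left(\int_{-\infty}^{+\infty}\left(e^{iux}-1-iux\mathbf 1_{|x|\le 1}\right)\frac{\alpha c}{|x|^{1+\alpha}}\,dx\right)$ for all $u\in\mathbb{R}$; equivalently, $\vartheta$ is the symmetric $\alpha$-stable law (no drift) with $\lim_{x\to+\infty}x^{\alpha}\,\mathbb{P}[\vartheta>x]=\lim_{x\to+\infty}x^\alpha\,\mathbb{P}[\vartheta<-x]=c$. Strong domain of attraction: a real random variable $V$ is in the strong domain of attraction of the symmetric $\alpha$-stable random variable $\vartheta$ with tail parameter $c$, with attraction index $\gamma_\alpha>0$, if, as $x\to+\infty$, $$\mathbb{P}[V>x]-\frac{c}{x^\alpha}=\mathcal{O}\left(\frac{1}{x^{\alpha+\gamma_\alpha}}\right),\qquad \mathbb{P}[V\le -x]-\frac{c}{x^\alpha}=\mathcal{O}\left(\frac{1}{x^{\alpha+\gamma_\alpha}}\right),$$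 with the same $c$ as for $\vartheta$. Here $g(x)=\mathcal{O}(x^{-p})$ means that there are $K,x_0\ge 0$ with $|g(x)|\le K x^{-p}$ for all $x\ge x_0$. Zolotarev distance: for $r>0$ write $r=m+\beta$ with $m\in\mathbb{N}=\{0,1,2,\dots\}$ and $\beta\in(0,1]$. Let $\Lambda_r$ be the set of bounded functions $f:\mathbb{R}\to\mathbb{R}$ that are $m$ times continuously differentiable and satisfy $|f^{(m)}(x)-f^{(m)}(y)|\le |x-y|^\beta$ for all $x,y\in\mathbb{R}$. For real random variables $X,Y$, $$\zeta_r(X,Y)=\sup_{f\in\Lambda_r}\left|\mathbb{E}[f(X)]-\mathbb{E}[f(Y)]\right|\in[0,\infty].$$ (For $r\in(1,2]$ one has $m=1$ and $\beta=r-1$.) *)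

(* Defs.v *)
From HB Require Import structures.
From mathcomp Require Import all_boot all_order all_algebra.
From mathcomp Require Import complex.
From mathcomp Require Import all_classical all_reals all_analysis.
From mathcomp Require Import measurable_realfun.

Set Implicit Arguments.
Unset Strict Implicit.
Unset Printing Implicit Defensive.

Import Order.TTheory GRing.Theory Num.Theory.
Import numFieldNormedType.Exports.

Local Open Scope classical_set_scope.
Local Open Scope ring_scope.
Local Open Scope complex_scope.

Definition cexp (R : realType) (z : R[i]) : R[i] :=
  (expR (complex.Re z) * cos (complex.Im z))
    +i* (expR (complex.Re z) * sin (complex.Im z)).

(* Componentwise; as for [Rintegral], the value is only meaningful when the
   real and imaginary parts of [f] are integrable. *)
Definition cintegral (d : measure_display) (T : measurableType d)
    (R : realType) (mu : {measure set T -> \bar R}) (f : T -> R[i]) : R[i] :=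
  Rintegral mu setT (fun x => complex.Re (f x))
    +i* Rintegral mu setT (fun x => complex.Im (f x)).

Definition char_fun (d : measure_display) (T : measurableType d)
    (R : realType) (P : probability T R) (X : {RV P >-> R}) (u : R) : R[i] :=
  cintegral P (fun w => cexp (0 +i* (u * X w))).

(* The integrand is 0 at x = 0, where the density |x|^-(1 + alpha) blows up,
   because 0^-1 = 0; this point is Lebesgue-negligible. *)
Definition stable_exponent (R : realType) (alpha c u : R) : R[i] :=
  cintegral (@lebesgue_measure R) (fun x : R =>
    (cexp (0 +i* (u * x)) - 1 - (0 +i* (u * x * (`|x| <= 1)%R%:R)))
      * (alpha * c / `|x| `^ (1 + alpha))%:C).

Definition symmetric_stable (d : measure_display) (T : measurableType d)
    (R : realType) (P : probability T R) (alpha c : R) (X : {RV P >-> R}) :=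
  0 < c /\ forall u : R, char_fun X u = cexp (stable_exponent alpha c u).

Definition bigO_power (R : realType) (g : R -> R) (p : R) :=
  exists K x0 : R, [/\ 0 <= K, 0 <= x0 &
    forall x : R, x0 <= x -> `|g x| <= K * x `^ (- p)].

Definition strong_attraction (d : measure_display) (T : measurableType d)
    (R : realType) (P : probability T R) (alpha c gamma : R)
    (V : {RV P >-> R}) :=
  [/\ 0 < gamma,
      bigO_power (fun x => fine (P [set w | V w > x]) - c / x `^ alpha)
        (alpha + gamma) &
      bigO_power (fun x => fine (P [set w | V w <= - x]) - c / x `^ alpha)
        (alpha + gamma)].

Definition independent_RVs (d : measure_display) (T : measurableType d)
    (R : realType) (P : probability T R) (V : nat -> {RV P >-> R}) :=
  forall (s : seq nat) (A : nat -> set R), uniq s ->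
    (forall k, measurable (A k)) ->
    P (\big[setI/setT]_(k <- s) (V k @^-1` A k)) =
      (\prod_(k <- s) P (V k @^-1` A k))%E.

Definition identically_distributed (d : measure_display)
    (T : measurableType d) (R : realType) (P : probability T R)
    (V : nat -> {RV P >-> R}) :=
  forall (k l : nat) (A : set R), measurable A ->
    distribution P (V k) A = distribution P (V l) A.

(* For r > 0 the decomposition r = m + beta with 0 < beta <= 1 exists and is
   unique. *)
Definition zolotarev_class (R : realType) (r : R) : set (R -> R) :=
  [set f : R -> R | exists (m : nat) (beta : R),
    [/\ r = m%:R + beta, 0 < beta & beta <= 1] /\
    [/\ bounded_fun f,
        forall k, (k < m)%N -> forall x : R, derivable (f^`(k))%classic x 1,
        continuous (f^`(m))%classic &
        forall x y : R, `|(f^`(m))%classic x - (f^`(m))%classic y| <= `|x - y| `^ beta]].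

Definition zolotarev (d : measure_display) (T : measurableType d)
    (d' : measure_display) (T' : measurableType d') (R : realType)
    (P : probability T R) (Q : probability T' R)
    (r : R) (X : {RV P >-> R}) (Y : {RV Q >-> R}) : \bar R :=
  ereal_sup [set `| 'E_P[f \o X] - 'E_Q[f \o Y] |%E |
             f in zolotarev_class r].

Section normalized_sum.
Context (d : measure_display) (T : measurableType d) (R : realType).
Context (P : probability T R) (alpha : R) (V : nat -> {RV P >-> R}) (n : nat).

(* The sequence is indexed from 0: [V k] is the (k+1)-st variable. *)
Definition normalized_sum : T -> R := fun w =>
  n%:R `^ (- alpha^-1) * \sum_(k < n) (V k w - fine 'E_P[V k]).

Let measurable_normalized_sum : measurable_fun setT normalized_sum.
Proof.
apply: measurable_funM; first exact: measurable_cst.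
apply: measurable_sum => k.
by apply: measurable_funB; [exact: measurable_funPT|exact: measurable_cst].
Qed.

HB.instance Definition _ :=
  isMeasurableFun.Build _ _ _ _ normalized_sum measurable_normalized_sum.

End normalized_sum.

(* Main.v *)
Require Import Defs.
From HB Require Import structures.
From mathcomp Require Import all_boot all_order all_algebra.
From mathcomp Require Import complex.
From mathcomp Require Import all_classical all_reals all_analysis.
From mathcomp Require Import measurable_realfun.
From mathcomp Require Import ring lra.

Set Implicit Arguments.
Unset Strict Implicit.
Unset Printing Implicit Defensive.

Import Order.TTheory GRing.Theory Num.Theory.
Import numFieldNormedType.Exports.

Local Open Scope classical_set_scope.
Local Open Scope ring_scope.

(** If the stable law theta were known to have power tails and to be stable
    under sums, the bound would follow at once from the two properties of
    zeta_r: it is subadditive over independent sums and zeta_r (a X, a Y) =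
    a^r zeta_r (X, Y), so that n summands of size n^(-1/alpha) cost
    n * n^(-r/alpha) * zeta_r (V - E V, theta).  Here theta is given only by
    its characteristic function, so its tails are never used: the normalized
    sums S_n are compared with each other along n, 2n, 4n, and so on, and theta
    enters only as their limit in law.

    Write X = V - E V, beta = r - 1, a_n = n^(-1/alpha), and let T_a f (x) =
    E f (x + a X) ([smear]).  By independence E f (S_n) is the n-th iterate of
    T_(a_n) applied to f, at 0 ([Rintegral_normalized_sum]), and T_a preserves
    the class of bounded functions whose derivative is beta-Hölder.

    One step costs a^r.  With b = 2^(-1/alpha), T_a and T_(ab)^2 differ by
    O(a^r) on that class ([dyadic_step]).  The second difference of f is at most
    |y| |z|^beta, so T_(ab)^2 f = 2 T_(ab) f - f up to E|X| E|X|^beta (ab)^r.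
    What is left is E phi (X) - 2 E phi (b X), where phi is the first-order
    Taylor remainder of f.  By the layer-cake formula E phi (X) is the integral
    of phi' against the tails of X, and replacing these tails by c x^(-alpha)
    costs a finite multiple of the Hölder constant of phi' because
    gamma > r - alpha ([tail_comparison_one_sided], [stable_tails]).  The
    resulting [stable_pairing] is homogeneous of degree alpha under dilations,
    and 2 b^alpha = 1, so the main terms cancel.

    Replacing the n summands one at a time gives |E f (S_n) - E f (S_2n)| <=
    C n a_n^r = C n^((alpha - r)/alpha), and since r > alpha the sum over
    n, 2n, 4n, ... is geometric ([smeared_sum_dyadic]).

    It remains to see that E f (S_N) tends to E f (theta).  Applied to cosines,
    the same tail comparison yields E cos (u S_N + b) -> exp (J u) cos b
    ([cvg_smeared_sum_cosine]), where J is the pairing that corresponds to the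
    cosine; a second application of the layer-cake formula, to the Lévy density,
    identifies J u with the exponent of theta ([stable_exponentE]).  Convergence
    of the cosine transforms implies convergence in law ([levy_continuity]):
    after convolution with a Cauchy density s / (s^2 + z^2), which is the
    integral of exp (- s u) cos (u z) over u > 0, the densities converge
    pointwise, hence in L^1 by Scheffé's lemma, and the convolution error is
    small uniformly over all laws. *)

(** * Lebesgue measure under affine maps *)

Section calculus.
Context {R : realType}.

Lemma is_derive_continuous (f f' : R -> R) :
  (forall x : R, is_derive x 1 f (f' x)) -> continuous f.
Proof.
move=> df x; apply/differentiable_continuous/derivable1_diffP.
by have [] := df x.
Qed.

End calculus.

Section lebesgue_affine.
Context {R : realType}.
Local Notation mu := (@lebesgue_measure R).
Local Open Scope ereal_scope.

Lemma measurable_affine (a b : R) :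
  measurable_fun [set: R] (fun x : R => a * x + b)%R.
Proof. by apply: measurable_funD => //; exact: measurable_funM. Qed.

(** It suffices to compare the two measures on half-open intervals, which
    generate the Borel sets. *)
Lemma lebesgue_measure_affine (a b : R) (a0 : (0 < a)%R) (A : set R) :
  measurable A ->
  mu A = a%:E * mu ((fun x : R => a * x + b)%R @^-1` A).
Proof.
move=> mA.
pose phi : measurableTypeR R -> measurableTypeR R := fun x : R => (a * x + b)%R.
have mphi : measurable_fun setT phi by exact: measurable_affine.
pose nu_ : {measure set (measurableTypeR R) -> \bar R} :=
  mscale (NngNum (ltW a0)) (pushforward mu phi).
pose nu := nu_ mphi.
change (mu A = nu A); apply: lebesgue_measure_unique => // _ [[x y]] _ <-.
rewrite /nu/nu_/= /mscale/= /pushforward.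
have -> : phi @^-1` [set` `]x, y]%R] = [set` `]((x - b) / a)%R, ((y - b) / a)%R]].
  by apply/seteqP; split=> z /=;
    rewrite /phi !in_itv/= ltr_pdivrMr// ler_pdivlMr// ltrBlDr lerBrDr (mulrC a).
rewrite !lebesgue_measure_itv/= !lte_fin ltr_pM2r ?invr_gt0// ltrD2r.
case: ifPn => _; last by rewrite mule0.
by rewrite -!EFinB -EFinM -mulrBl mulrCA mulfV ?gt_eqF// mulr1 opprB addrA subrK.
Qed.

Lemma ge0_integral_affine (a b : R) (f : R -> \bar R) : (0 < a)%R ->
  measurable_fun setT f -> (forall x, 0 <= f x) ->
  \int[mu]_x f x = a%:E * \int[mu]_x f (a * x + b)%R.
Proof.
move=> a0 mf f0.
pose phi : measurableTypeR R -> measurableTypeR R := fun x : R => (a * x + b)%R.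
have mphi : measurable_fun setT phi by exact: measurable_affine.
pose nu_ : {measure set (measurableTypeR R) -> \bar R} :=
  mscale (NngNum (ltW a0)) (pushforward mu phi).
pose nu := nu_ mphi.
transitivity (\int[nu]_x f x).
  apply: eq_measure_integral => //= A mA _.
  exact: lebesgue_measure_affine.
rewrite ge0_integral_mscale//=.
by rewrite (ge0_integral_pushforward mphi).
Qed.

End lebesgue_affine.

(** * Integrals of powers *)

Section power_integrals.
Context {R : realType}.
Local Notation mu := (@lebesgue_measure R).

Lemma cvg_powRN_pinfty (p : R) : 0 < p -> x `^ (- p) @[x --> +oo] --> (0 : R).
Proof.
move=> p0; apply/cvgrPdist_le => e e0; near=> x.
have x0 : 0 < x by near: x; exact: nbhs_pinfty_gt.
rewrite sub0r normrN ger0_norm ?powR_ge0//.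
have : e `^ (- p^-1) <= x by near: x; apply: nbhs_pinfty_ge.
move=> ex; rewrite powRN -[leRHS]invrK lef_pV2 ?posrE ?invr_gt0 ?powR_gt0//.
have -> : e^-1 = (e `^ (- p^-1)) `^ p.
  by rewrite -powRrM mulNr mulVf ?gt_eqF// powRN powRr1 // ltW.
by rewrite ge0_ler_powR ?nnegrE ?powR_ge0// ltW.
Unshelve. all: by end_near. Qed.

Lemma continuous_powR_gt0 (q x : R) : 0 < x -> {for x, continuous (fun y : R => y `^ q)}.
Proof.
move=> x0; apply/differentiable_continuous/derivable1_diffP.
by apply: derivable_powR; rewrite in_itv/= x0.
Qed.

Lemma measurable_tail_weight (alpha c : R) :
  measurable_fun setT (fun x : R => c / x `^ alpha).
Proof.
have -> : (fun x : R => c / x `^ alpha) = (fun x => c * x `^ (- alpha)).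
  by apply/funext => x; rewrite powRN.
by apply: measurable_funM => //; exact: measurable_powR.
Qed.

Lemma gt0_powR_div (x p q : R) : 0 < x -> x `^ p / x `^ q = x `^ (p - q).
Proof. by move=> x0; rewrite -powRN -powRD// (gt_eqF x0) implybT. Qed.

Lemma is_derive_powR_primitive (q x : R) : 0 < x -> q + 1 != 0 ->
  is_derive x 1 (fun y : R => y `^ (q + 1) / (q + 1)) (x `^ q).
Proof.
move=> x0 q1.
have -> : (fun y : R => y `^ (q + 1) / (q + 1)) = (q + 1)^-1 \*: (fun y : R => y `^ (q + 1)).
  by apply/funext => y /=; rewrite mulrC.
have ? := is_derive1_powR (q + 1) x0.
by apply: is_derive_eq; rewrite addrK scalerA mulVf// scale1r.
Qed.

Lemma integral_powR_cy (a q : R) : 0 < a -> q < -1 ->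
  (\int[mu]_(x in `[a, +oo[) (x `^ q)%:E = (- (a `^ (q + 1) / (q + 1)))%:E)%E.
Proof.
move=> a0 q1.
have q10 : q + 1 != 0 by rewrite lt_eqF// -ltrBrDr sub0r.
rewrite (@ge0_continuous_FTC2y _ _ (fun y : R => y `^ (q + 1) / (q + 1)) _ 0).
- by rewrite -EFinB sub0r.
- by move=> x _; exact: powR_ge0.
- apply: continuous_in_subspaceT => x; rewrite inE/= in_itv/= andbT => ax.
  by apply: continuous_powR_gt0; rewrite (lt_le_trans a0).
- rewrite -[X in _ --> X](mul0r (q + 1)^-1); apply: cvgM; last exact: cvg_cst.
  have -> : q + 1 = - (- (q + 1)) by rewrite opprK.
  by apply: cvg_powRN_pinfty; rewrite oppr_gt0 -ltrBrDr sub0r.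
- move=> x ax; apply: ex_derive; apply: is_derive_powR_primitive => //.
  exact: (lt_trans a0).
- apply: cvg_at_right_filter; apply: cvgM; [exact: continuous_powR_gt0|exact: cvg_cst].
- move=> x; rewrite in_itv/= andbT => ax; rewrite derive1E.
  by apply: derive_val; apply: is_derive_powR_primitive => //; exact: (lt_trans a0).
Qed.

Lemma integral_powR_cc (a b q : R) : 0 < a -> a < b -> q + 1 != 0 ->
  (\int[mu]_(x in `[a, b]) (x `^ q)%:E =
   (b `^ (q + 1) / (q + 1) - a `^ (q + 1) / (q + 1))%:E)%E.
Proof.
move=> a0 ab q10.
have dF x : 0 < x -> {for x, continuous (fun y : R => y `^ (q + 1) / (q + 1))}.
  by move=> x0; apply: cvgM; [exact: continuous_powR_gt0|exact: cvg_cst].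
rewrite (@continuous_FTC2 _ _ (fun y : R => y `^ (q + 1) / (q + 1))) ?EFinB//.
- apply: continuous_in_subspaceT => x; rewrite inE/= in_itv/= => /andP[ax _].
  by apply: continuous_powR_gt0; rewrite (lt_le_trans a0).
- split.
  + move=> x; rewrite in_itv/= => /andP[ax _].
    apply: ex_derive; apply: is_derive_powR_primitive => //.
    exact: (lt_trans a0).
  + by apply: cvg_at_right_filter; exact: dF.
  + by apply: cvg_at_left_filter; apply: dF; exact: lt_trans ab.
- move=> x; rewrite in_itv/= => /andP[ax _]; rewrite derive1E.
  by apply: derive_val; apply: is_derive_powR_primitive => //; exact: (lt_trans a0).
Qed.

(** The integrand may blow up at 0, so the primitive is applied on the
    intervals [b/(n+2), b], which exhaust the domain. *)
Lemma integral_powR_oc_lty (b q : R) : 0 < b -> -1 < q ->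
  (\int[mu]_(x in `]0%R, b]) (x `^ q)%:E < +oo)%E.
Proof.
move=> b0 q1.
have q10 : 0 < q + 1 by rewrite -ltrBlDr sub0r.
pose F (n : nat) : set R := [set` `[b / n.+2%:R, b]%R].
have bn n : 0 < b / n.+2%:R by rewrite divr_gt0.
have -> : `]0%R, b]%classic = \bigcup_n F n.
  apply/seteqP; split=> x /=.
    rewrite in_itv/= => /andP[x0 xb].
    exists (Num.truncn (b / x)) => //; rewrite /F/= in_itv/= xb andbT.
    rewrite ler_pdivrMr// mulrC -ler_pdivrMr//.
    apply: ltW; apply: lt_trans (Num.Theory.truncnS_gt _) _.
    by rewrite ltr_nat.
  by move=> [n _]; rewrite /F/= !in_itv/= => /andP[xb ->]; rewrite (lt_le_trans (bn n) xb).
have H := @ge0_nondecreasing_set_cvg_integral _ (measurableTypeR R) R F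
  (fun x : R => (x `^ q)%:E) mu.
have {}H : (\int[mu]_(x in F i) (x `^ q)%:E @[i --> \oo] -->
    \int[mu]_(x in \bigcup_i F i) (x `^ q)%:E)%E.
  apply: H.
  - move=> m n mn; apply/subsetPset => x; rewrite /F/= !in_itv/= => /andP[h ->].
    rewrite andbT; apply: le_trans h; rewrite ler_pM2l// lef_pV2 ?posrE//.
    by rewrite ler_nat.
  - by move=> i; exact: measurable_itv.
  - by move=> i; apply/measurable_EFinP; apply: measurable_funTS; exact: measurable_powR.
  - by move=> i x _; rewrite lee_fin powR_ge0.
rewrite -(cvg_lim _ H)//.
apply: (@le_lt_trans _ _ ((b `^ (q + 1) / (q + 1))%:E)); last exact: ltry.
apply: lime_le; first by apply/cvg_ex; eexists; exact: H.
apply: nearW => n; rewrite /F integral_powR_cc ?gt_eqF//.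
  by rewrite lee_fin lerBlDr lerDl divr_ge0 ?powR_ge0// ltW.
by rewrite ltr_pdivrMr// ltr_pMr// ltr1n.
Qed.

Lemma integrable_powR_oc (b q : R) : 0 < b -> -1 < q ->
  mu.-integrable `]0, b] (EFin \o (fun x : R => x `^ q)).
Proof.
move=> b0 q1; apply/integrableP; split.
  by apply/measurable_EFinP; apply: measurable_funTS; exact: measurable_powR.
under eq_integral do rewrite /= ger0_norm ?powR_ge0//.
exact: integral_powR_oc_lty.
Qed.

Lemma integrable_powR_oy (a q : R) : 0 < a -> q < -1 ->
  mu.-integrable `]a, +oo[ (EFin \o (fun x : R => x `^ q)).
Proof.
move=> a0 q1.
have H : mu.-integrable `[a, +oo[ (EFin \o (fun x : R => x `^ q)).
  apply/integrableP; split.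
    by apply/measurable_EFinP; apply: measurable_funTS; exact: measurable_powR.
  under eq_integral do rewrite /= ger0_norm ?powR_ge0//.
  by rewrite integral_powR_cy// ltry.
apply: integrableS H => //.
by apply: subset_itvr; rewrite bnd_simp.
Qed.

(** All the integrals against c / x^alpha converge for this reason: the
    integrand is O(x^(beta - alpha)) at 0 and O(x^(- alpha)) at infinity. *)
Lemma integrable_two_powers (k : R -> R) (a A B p q : R) : 0 < a ->
  measurable_fun setT k -> -1 < p -> q < -1 ->
  (forall x, 0 < x -> x <= a -> `|k x| <= A * x `^ p) ->
  (forall x, a < x -> `|k x| <= B * x `^ q) ->
  mu.-integrable `]0, +oo[ (EFin \o k).
Proof.
move=> a0 mk p1 q1 kp kq.
have -> : `]0%R, +oo[%classic = `]0, a]%classic `|` `]a, +oo[%classic :> set R.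
  apply/esym; rewrite -itv_bndbnd_setU ?bnd_simp//; exact: ltW.
apply/integrableP; split.
  by apply/measurable_EFinP; apply: measurable_funTS.
rewrite ge0_integral_setU//=.
- apply: lte_add_pinfty.
  + have /integrableP[_] : mu.-integrable `]0, a] (EFin \o k).
      have : mu.-integrable `]0, a] (fun x => A%:E * (x `^ p)%:E)%E.
        by apply: integrableZl => //; exact: integrable_powR_oc.
      apply: le_integrable => //.
      * by apply/measurable_EFinP; exact: measurable_funTS.
      * move=> x /=; rewrite in_itv/= => /andP[x0 xa].
        by rewrite lee_fin; apply: le_trans (kp _ x0 xa) _; exact: ler_norm.
    by [].
  + have /integrableP[_] : mu.-integrable `]a, +oo[ (EFin \o k).
      have : mu.-integrable `]a, +oo[ (fun x => B%:E * (x `^ q)%:E)%E.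
        by apply: integrableZl => //; exact: integrable_powR_oy.
      apply: le_integrable => //.
      * by apply/measurable_EFinP; exact: measurable_funTS.
      * move=> x /=; rewrite in_itv/= andbT => ax.
        by rewrite lee_fin; apply: le_trans (kq _ ax) _; exact: ler_norm.
    by [].
- by apply/measurable_EFinP; apply: measurable_funTS; exact: measurableT_comp.
- apply/disj_setPS => x [] /=; rewrite !in_itv/= andbT => /andP[_ xa] ax.
  by move: (lt_le_trans ax xa); rewrite ltxx.
Qed.

End power_integrals.

(** * The layer-cake formula *)

Section layer_cake.
Context {R : realType} {d : measure_display} {T : measurableType d}.
Local Notation mu := (@lebesgue_measure R).

(** Closing or opening the right end of the interval changes nothing, which
    is what lets [layer_cake] treat weak and strict tails together. *)
Lemma integral_derive_from0 (phi phi' : R -> R) (b : bool) (y : R) : 0 <= y ->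
  phi 0 = 0 -> (forall x : R, is_derive x 1 phi (phi' x)) -> continuous phi' ->
  (\int[mu]_(x in [set` Interval (BRight 0%R) (BSide b y)]) (phi' x)%:E
    = (phi y)%:E)%E.
Proof.
move=> y0 phi0 dphi cphi'.
have mphi' D : measurable_fun D phi'.
  by apply: measurable_funTS; exact: continuous_measurable_fun.
have -> : (\int[mu]_(x in [set` Interval (BRight 0%R) (BSide b y)]) (phi' x)%:E
    = \int[mu]_(x in `[0%R, y]) (phi' x)%:E)%E.
  rewrite integral_itv_obnd_cbnd; last exact/measurable_EFinP.
  by case: b => //; rewrite integral_itv_bndo_bndc//; exact/measurable_EFinP.
move: y0; rewrite le_eqVlt => /predU1P[<-|y0].
  by rewrite set_itv1 integral_set1 phi0.
have cphi := is_derive_continuous dphi.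
rewrite (@continuous_FTC2 _ _ phi) ?phi0 ?sube0//.
- exact: continuous_subspaceT.
- split; first by move=> x _; exact: ex_derive.
  + by apply: cvg_at_right_filter; exact: cphi.
  + by apply: cvg_at_left_filter; exact: cphi.
- by move=> x _; rewrite derive1E derive_val.
Qed.

(** phi (Y t) is the integral of phi' over the x below Y t, so exchanging the
    two integrals leaves phi' weighted by the tail H of Y.  The measure m is
    only sigma-finite and carries a density rho, in order that the formula
    apply to the laws of random variables and to the infinite Lévy measure
    alike.  The flag s distinguishes P [Y > x] from P [Y >= x]: the hypotheses
    on V bound P [V > x] on the right but P [V <= - x] on the left. *)
Lemma layer_cake (m : {sigma_finite_measure set T -> \bar R})
    (Y rho : T -> R) (phi phi' H : R -> R) (s : bool) :
  measurable_fun setT Y -> (forall t, 0 <= Y t) ->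
  measurable_fun setT rho -> (forall t, 0 <= rho t) ->
  phi 0 = 0 -> (forall x : R, is_derive x 1 phi (phi' x)) -> continuous phi' ->
  (forall x, 0 < x ->
    (\int[m]_t (rho t * (x < Y t ?<= if s)%:R)%:E = (H x)%:E)%E) ->
  mu.-integrable `]0, +oo[ (EFin \o (fun x => phi' x * H x)) ->
  m.-integrable setT (EFin \o (fun t => phi (Y t) * rho t)) /\
  \int[m]_t (phi (Y t) * rho t) = \int[mu]_(x in `]0, +oo[) (phi' x * H x).
Proof.
move=> mY Y0 mrho rho0 phi0 dphi cphi' HE iH.
pose D : set (measurableTypeR R) := `]0, +oo[%classic.
pose f (z : measurableTypeR R * T) : R :=
  (phi' \_ D) z.1 * (rho z.2 * (z.1 < Y z.2 ?<= if s)%:R).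
pose g : R -> R := fun x => phi' x * H x.
have mphi' : measurable_fun setT phi' by exact: continuous_measurable_fun.
have mf : measurable_fun setT f.
  apply: measurable_funM.
    apply: (measurableT_comp (f := phi' \_ D)) => //.
    apply/(measurable_restrictT _ _).1 => //.
      exact: measurable_itv.
    exact: (measurable_funS _ _ mphi').
  apply: measurable_funM.
    by apply: measurableT_comp.
  have mlt : measurable_fun setT (fun z : measurableTypeR R * T => z.1 < Y z.2 ?<= if s).
    have mYz : measurable_fun setT (fun z : measurableTypeR R * T => Y z.2).
      by apply: measurableT_comp.
    by case: (s) => /=; [exact: measurable_fun_ler|exact: measurable_fun_ltr].
  by apply: (measurableT_comp (f := fun b : bool => (b%:R : R))).
have mf' : measurable_fun setT (EFin \o f) by exact/measurable_EFinP.
have inner1 x t : (f (x, t))%:E = (((phi' \_ D) x)%:E *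
   (rho t * (x < Y t ?<= if s)%:R)%:E)%E by rewrite -EFinM.
have mslice x : measurable_fun setT (fun t => rho t * (x < Y t ?<= if s)%:R).
  apply: measurable_funM => //.
  apply: (measurableT_comp (f := fun b : bool => (b%:R : R))) => //.
  by case: (s) => /=; [exact: measurable_fun_ler|exact: measurable_fun_ltr].
have slice0 x t : 0 <= rho t * (x < Y t ?<= if s)%:R by rewrite mulr_ge0.
have slice0E x t : (0 <= (rho t * (x < Y t ?<= if s)%:R)%:E)%E by rewrite lee_fin.
have normx x : (\int[m]_t `|(f (x, t))%:E| =
   `| ((EFin \o g) \_ D) x |)%E.
  under eq_integral do rewrite inner1 abseM (gee0_abs (slice0E _ _)).
  rewrite ge0_integralZl//; last exact/measurable_EFinP.
  rewrite /patch; case: ifPn => xD; last by rewrite !abse0 mul0e.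
  move: xD; rewrite inE /D/= in_itv/= andbT => x0.
  have Hx0 : 0 <= H x.
    by rewrite -lee_fin -HE//; apply: integral_ge0 => t _; exact: slice0E.
  by rewrite HE//= /g normrM (ger0_norm Hx0) EFinM.
have fint : (mu \x m)%E.-integrable setT (EFin \o f).
  apply/integrable12ltyP; first exact/measurable_EFinP.
  under eq_integral do rewrite /= normx.
  have /integrableP[_] := iH.
  suff -> : (\int[mu]_(x in D) `|(EFin \o g) x| =
      \int[mu]_x `|((EFin \o g) \_ D) x|)%E by [].
  rewrite integral_mkcond; apply: eq_integral => x _.
  by rewrite -[LHS]/(((abse \o (EFin \o g)) \_ D) x) restrict_abse.
have F12 := @Fubini _ _ _ _ R mu m (EFin \o f) fint.
have inner2 t : (\int[mu]_x (f (x, t))%:E = (phi (Y t) * rho t)%:E)%E.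
  pose S : set (measurableTypeR R) :=
    [set` Interval (BRight 0%R) (BSide (~~ s) (Y t))].
  have mS : measurable S by exact: measurable_itv.
  have iS : mu.-integrable S (EFin \o phi').
    have iC : mu.-integrable `[0%R, Y t] (EFin \o phi').
      apply: continuous_compact_integrable; first exact: segment_compact.
      exact: continuous_subspaceT.
    apply: integrableS iC => //.
    by apply: subset_itv; rewrite bnd_simp//; case: (s).
  rewrite (mulrC (phi _)) EFinM -(integral_derive_from0 (~~ s) (Y0 t) phi0 dphi cphi').
  rewrite -integralZl// [RHS]integral_mkcond; apply: eq_integral => x _.
  rewrite inner1 -EFinM /patch /S /D /=.
  rewrite !mem_setE !in_itv/= andbT.
  have -> : ((0 < x) && (x < Y t ?<= if ~~ ~~ s)) =
      (0 < x) && (x < Y t ?<= if s) by rewrite negbK.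
  by case: (0 < x) => /=; case: (x < Y t ?<= if s); rewrite ?mul0r ?mulr0 ?mulr1//= mulrC.
have inner3 x : (\int[m]_t (f (x, t))%:E =
    ((EFin \o g) \_ D) x)%E.
  under eq_integral do rewrite inner1.
  rewrite /patch; case: ifPn => xD; last first.
    by under eq_integral do rewrite mul0e; rewrite integral0.
  move: xD; rewrite inE /D/= in_itv/= andbT => x0.
  rewrite integralZl// ?HE//.
  apply/integrableP; split; first exact/measurable_EFinP.
  under eq_integral do rewrite gee0_abs//.
  by rewrite HE// ltry.
split.
  apply/integrableP; split.
    apply/measurable_EFinP; apply: measurable_funM => //.
    apply: (measurableT_comp (f := phi)) => //.
    apply: continuous_measurable_fun; exact: is_derive_continuous dphi.
  have := (@integrable21ltyP _ _ _ _ R mu m _ mf').1 fint.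
  apply: le_lt_trans; apply: ge0_le_integral => //.
  - apply/measurable_EFinP; apply: measurableT_comp => //.
    apply: measurable_funM => //.
    apply: (measurableT_comp (f := phi)) => //.
    apply: continuous_measurable_fun; exact: is_derive_continuous dphi.
  - apply: (@measurable_fun_fubini_tonelli_G _ _ _ _ R mu (abse \o (EFin \o f))) => //.
      exact: measurableT_comp.
    by move=> z; exact: abse_ge0.
  - move=> t _; rewrite -[X in (`|X| <= _)%E]inner2.
    apply: le_abse_integral => //.
    apply: (measurableT_comp mf'); exact: pair2_measurable.
rewrite /Rintegral; congr fine.
under eq_integral do rewrite -inner2.
by rewrite -F12 [RHS]integral_mkcond; apply: eq_integral => x _; rewrite -inner3.
Qed.

End layer_cake.

(** * Comparison with the tails of the stable law *)

Section domination.
Context {R : realType} {d : measure_display} {T : measurableType d}.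
Variable m : {measure set T -> \bar R}.

Lemma integrable_le (D : set T) (f g : T -> R) : measurable D ->
  measurable_fun D f -> (forall x, D x -> `|f x| <= g x) ->
  m.-integrable D (EFin \o g) -> m.-integrable D (EFin \o f).
Proof.
move=> mD mf fg; apply: le_integrable => //; first exact/measurable_EFinP.
by move=> x Dx /=; rewrite lee_fin (le_trans (fg _ Dx))// ler_norm.
Qed.

Lemma normr_Rintegral_le (D : set T) (f g : T -> R) : measurable D ->
  measurable_fun D f -> (forall x, D x -> `|f x| <= g x) ->
  m.-integrable D (EFin \o g) -> `|\int[m]_(x in D) f x| <= \int[m]_(x in D) g x.
Proof.
move=> mD mf fg ig.
have if_ := integrable_le mD mf fg ig.
apply: le_trans (le_normr_Rintegral mD if_) _.
apply: le_Rintegral => //.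
exact: (integrable_norm if_).
Qed.

Lemma integrableZ_real (D : set T) (k : R) (f : T -> R) : measurable D ->
  m.-integrable D (EFin \o f) -> m.-integrable D (EFin \o (fun x => k * f x)).
Proof. by move=> mD; exact: integrableZl. Qed.

Lemma integrableD_real (D : set T) (f g : T -> R) : measurable D ->
  m.-integrable D (EFin \o f) -> m.-integrable D (EFin \o g) ->
  m.-integrable D (EFin \o (fun x => f x + g x)).
Proof. by move=> mD; exact: integrableD. Qed.

Lemma integrableB_real (D : set T) (f g : T -> R) : measurable D ->
  m.-integrable D (EFin \o f) -> m.-integrable D (EFin \o g) ->
  m.-integrable D (EFin \o (fun x => f x - g x)).
Proof. by move=> mD; exact: integrableB. Qed.

End domination.

Section tail_comparison_one_sided.
Context {R : realType} {d : measure_display} {T : measurableType d}.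
Local Notation mu := (@lebesgue_measure R).

(** By the layer-cake formula the difference is the integral of
    phi' x (H x - c / x^alpha), where H is the tail of Y.  So the constant is
    the integral of x^beta |H x - c / x^alpha|: near 0 it converges because
    beta - alpha > -1, and at infinity because beta - alpha - gamma < -1.
    The bound G makes the two integrals converge separately and does not
    enter the constant. *)
Lemma tail_comparison_one_sided (P : probability T R) (Y : T -> R) (s : bool)
    (alpha beta gamma c K0 x0 : R) :
  1 < alpha -> 0 <= beta -> alpha < 1 + beta -> 1 + beta - alpha < gamma ->
  0 <= c -> 0 <= K0 ->
  measurable_fun setT Y -> (forall t, 0 <= Y t) ->
  (forall x, x0 <= x ->
    `|fine (P [set t | x < Y t ?<= if s]) - c / x `^ alpha|
      <= K0 * x `^ (- (alpha + gamma))) ->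
  exists2 C, 0 <= C & forall (K G : R) (phi phi' : R -> R),
    phi 0 = 0 -> (forall x : R, is_derive x 1 phi (phi' x)) ->
    continuous phi' -> (forall x, `|phi' x| <= G) ->
    (forall x, 0 < x -> `|phi' x| <= K * x `^ beta) ->
    [/\ P.-integrable setT (EFin \o (fun t => phi (Y t))),
        mu.-integrable `]0, +oo[ (EFin \o (fun x => phi' x * (c / x `^ alpha))) &
    `|\int[P]_t phi (Y t) -
      \int[mu]_(x in `]0, +oo[) (phi' x * (c / x `^ alpha))| <= C * K].
Proof.
move=> alpha1 beta0 alphabeta gammab c0 K00 mY Y0 tail.
have alpha0 : 0 < alpha by rewrite (lt_trans _ alpha1).
have gamma0 : 0 < gamma by rewrite (lt_trans _ gammab)// subr_gt0.
pose H x := fine (P [set t | x < Y t ?<= if s]).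
have mset x : measurable [set t | x < Y t ?<= if s].
  have -> : [set t | x < Y t ?<= if s] = Y @^-1` [set` Interval (BSide s x) +oo%O].
    by apply/seteqP; split => t /=; rewrite in_itv/= andbT.
  by rewrite -[X in measurable X]setTI; exact: mY.
have PE x : P [set t | x < Y t ?<= if s] = (H x)%:E.
  by rewrite /H fineK// fin_num_measure.
have H0 x : 0 <= H x by rewrite /H fine_ge0.
have H1 x : H x <= 1 by rewrite -lee_fin -PE probability_le1.
have mH : measurable_fun setT H.
  apply: nonincreasing_measurable => // x y xy.
  rewrite -lee_fin -!PE le_measure ?inE// => t /=.
  by case: (s) => /=; [exact: le_trans xy|exact: le_lt_trans xy].
pose a := Num.max 1 x0.
have a0 : 0 < a by rewrite /a lt_max ltr01.
have a1 : 1 <= a by rewrite /a le_max lexx.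
have taila x : a < x -> `|H x - c / x `^ alpha| <= K0 * x `^ (- (alpha + gamma)).
  by move=> ax; apply: tail; rewrite (le_trans _ (ltW ax))// /a le_max lexx orbT.
have mpow p : measurable_fun setT (fun x : R => x `^ p) by exact: measurable_powR.
have mc := measurable_tail_weight alpha c.
pose D x := x `^ beta * `|H x - c / x `^ alpha|.
have mD : measurable_fun setT D.
  apply: measurable_funM => //; apply: measurableT_comp => //.
  exact: measurable_funB.
have iD : mu.-integrable `]0, +oo[ (EFin \o D).
  (* Below a only H <= 1 is available, and x^beta <= a^alpha x^(beta - alpha). *)
  apply: (@integrable_two_powers _ D a (a `^ alpha + c) K0
    (beta - alpha) (beta - (alpha + gamma))) => //.
  - by rewrite ltrBrDr addrC -ltrBrDr opprK addrC.
  - by move: gammab; lra.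
  - move=> x xgt0 xa; rewrite /D normrM normr_id (ger0_norm (powR_ge0 _ _)).
    apply: (@le_trans _ _ (x `^ beta * (1 + c / x `^ alpha))).
      apply: ler_wpM2l; first exact: powR_ge0.
      apply: le_trans (ler_normB _ _) _.
      by apply: lerD; rewrite ger0_norm// divr_ge0// powR_ge0.
    rewrite mulrDr mulr1 mulrCA gt0_powR_div// mulrDl lerD2r.
    rewrite -[leLHS](@mulfVK _ (x `^ alpha)) ?gt_eqF ?powR_gt0//.
    rewrite gt0_powR_div// mulrC ler_wpM2r ?powR_ge0//.
    by rewrite ge0_ler_powR ?nnegrE ?(ltW xgt0) ?(ltW a0) ?(ltW alpha0).
  - move=> x ax; rewrite /D normrM normr_id (ger0_norm (powR_ge0 _ _)).
    have xgt0 := lt_trans a0 ax.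
    apply: le_trans (ler_wpM2l (powR_ge0 _ _) (taila _ ax)) _.
    by rewrite mulrCA -powRD ?(gt_eqF xgt0) ?implybT.
exists (\int[mu]_(x in `]0, +oo[) D x).
  by apply: Rintegral_ge0 => x _; rewrite /D mulr_ge0// powR_ge0.
move=> K G phi phi' phi0 dphi cphi' phi'G phi'K.
have mphi' : measurable_fun setT phi' by exact: continuous_measurable_fun.
have i1 : mu.-integrable `]0, +oo[ (EFin \o (fun x => phi' x * (c / x `^ alpha))).
  apply: (@integrable_two_powers _ _ a (K * c) (G * c) (beta - alpha) (- alpha)) => //.
  - exact: measurable_funM.
  - by rewrite ltrBrDr addrC -ltrBrDr opprK addrC.
  - by rewrite ltrN2.
  - move=> x xgt0 xa; rewrite normrM (ger0_norm (divr_ge0 c0 (powR_ge0 _ _))).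
    rewrite -gt0_powR_div// mulrACA; apply: le_trans (ler_wpM2r _ (phi'K _ xgt0)) _.
      by rewrite divr_ge0// powR_ge0.
    by rewrite mulrACA.
  - move=> x ax; rewrite normrM (ger0_norm (divr_ge0 c0 (powR_ge0 _ _))).
    rewrite powRN -mulrA; apply: ler_wpM2r (phi'G _).
    by rewrite divr_ge0// powR_ge0.
have i2 : mu.-integrable `]0, +oo[ (EFin \o (fun x => phi' x * (H x - c / x `^ alpha))).
  apply: (@integrable_le _ _ (measurableTypeR R) mu _ _ (fun x => K * D x)) => //.
  - by apply: measurable_funTS; apply: measurable_funM => //; exact: measurable_funB.
  - move=> x /=; rewrite in_itv/= andbT => xgt0.
    by rewrite normrM /D mulrA; apply: ler_wpM2r => //; exact: phi'K.
  - exact: integrableZ_real.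
have i3 : mu.-integrable `]0, +oo[ (EFin \o (fun x => phi' x * H x)).
  have -> : EFin \o (fun x => phi' x * H x) = (fun x =>
     (phi' x * (c / x `^ alpha))%:E + (phi' x * (H x - c / x `^ alpha))%:E)%E.
    by apply/funext => x /=; rewrite -EFinD -mulrDr addrCA subrr addr0.
  exact: integrableD.
have [] := @layer_cake _ _ _ P Y (cst 1) phi phi' H s mY Y0 _ _ phi0 dphi cphi' _ i3 => //.
  move=> x xgt0.
  under eq_integral do rewrite /= mul1r.
  rewrite -PE (_ : [set t | _] = [set t | x < Y t ?<= if s] `&` setT); last by rewrite setIT.
  rewrite -integral_indic//; apply: eq_integral => t _.
  by rewrite indicE mem_setE.
rewrite (_ : (fun t => phi (Y t) * cst 1 t) = (fun t => phi (Y t))); last first.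
  by apply/funext => t; rewrite /= mulr1.
move=> iphi ->; split=> //.
rewrite -RintegralB//.
under eq_Rintegral do rewrite -mulrBr.
rewrite mulrC -RintegralZl//.
apply: (@normr_Rintegral_le _ _ (measurableTypeR R) mu) => //.
- by apply: measurable_funTS; apply: measurable_funM => //; exact: measurable_funB.
- move=> x /=; rewrite in_itv/= andbT => xgt0.
  by rewrite normrM /D mulrA; apply: ler_wpM2r => //; exact: phi'K.
- exact: integrableZ_real.
Qed.

End tail_comparison_one_sided.

Section mean_value.
Context {R : realType}.

Lemma mean_value (f f' : R -> R) (a b : R) :
  (forall x : R, is_derive x 1 f (f' x)) ->
  exists2 z, `|z - a| <= `|b - a| & f b - f a = f' z * (b - a).
Proof.
move=> df.
have cf := is_derive_continuous df.
have [ab|ba|->] := ltgtP a b.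
- have [z zab ->] := MVT ab (fun x _ => df x) (continuous_subspaceT cf).
  exists z => //; move: zab; rewrite in_itv/= => /andP[az zb].
  by rewrite !ger0_norm ?subr_ge0 ?(ltW az) ?(ltW ab)// lerD2r ltW.
- have [z zab E] := MVT ba (fun x _ => df x) (continuous_subspaceT cf).
  exists z => /=.
    move: zab; rewrite in_itv/= => /andP[bz za].
    by rewrite !ler0_norm ?subr_le0 ?(ltW za) ?(ltW ba)// lerN2 lerD2r ltW.
  by rewrite -(opprB b a) mulrN in E; rewrite -[LHS]opprB E opprK.
- by exists b; rewrite ?subrr ?mulr0.
Qed.

Lemma powR_le1D (t b : R) : 0 <= t -> 0 <= b -> b <= 1 -> t `^ b <= 1 + t.
Proof.
move=> t0 b0 b1; have [t1|/ltW t1] := leP t 1.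
  apply: (@le_trans _ _ 1); last by rewrite lerDl.
  have <- : 1 `^ b = 1 :> R by rewrite powR1.
  by rewrite ge0_ler_powR// nnegrE.
by rewrite (le_trans (ler1_powR t1 b1))// lerDr.
Qed.

End mean_value.

Section tail_comparison.
Context {R : realType}.
Local Notation mu := (@lebesgue_measure R).

(** The integral of phi against the Lévy measure
    alpha c |x|^(- 1 - alpha) dx, integrated by parts: k stands for phi',
    which is what the layer-cake formula pairs with the tails c / x^alpha. *)
Definition stable_pairing (alpha c : R) (k : R -> R) : R :=
  \int[mu]_(x in `]0, +oo[) ((k x - k (- x)) * (c / x `^ alpha)).

(** K is the seminorm that scales like a power of a and controls all the
    estimates, while G only guarantees convergence of integrals. *)
Definition tail_class (beta K G : R) (phi phi' : R -> R) :=
  [/\ phi 0 = 0, (forall x : R, is_derive x 1 phi (phi' x)), continuous phi',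
      (forall x, `|phi' x| <= G) & (forall x, `|phi' x| <= K * `|x| `^ beta)].

Lemma tail_class_integrable (d : measure_display) (T : measurableType d)
    (P : probability T R) (X : T -> R) beta K G phi phi' :
  P.-integrable setT (EFin \o X) -> tail_class beta K G phi phi' ->
  P.-integrable setT (EFin \o (fun t => phi (X t))).
Proof.
move=> iX [phi0 dphi cphi' phiG _].
have mX : measurable_fun setT X by apply/measurable_EFinP; case/integrableP: iX.
apply: (@integrable_le _ _ _ P _ _ (fun t => G * `|X t|)) => //.
- apply: measurableT_comp => //; apply: continuous_measurable_fun.
  exact: is_derive_continuous dphi.
- move=> t _; have [z _] := mean_value 0 (X t) dphi.
  by rewrite phi0 !subr0 => ->; rewrite normrM ler_wpM2r.
- apply: integrableZ_real => //; exact: (integrable_norm iX).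
Qed.

(** The law of X is at finite zeta_(1 + beta) distance from the power tails:
    this is all that is retained from the strong domain of attraction. *)
Definition stable_tails (d : measure_display) (T : measurableType d)
    (P : probability T R) (alpha beta c : R) (X : T -> R) :=
  exists2 C, 0 <= C & forall K G phi phi', tail_class beta K G phi phi' ->
    `|\int[P]_t phi (X t) - stable_pairing alpha c phi'| <= C * K.

(** The positive and negative parts of V are handled separately, with phi and
    with its reflection. *)
Lemma stable_tails_of_tail_bounds (d : measure_display) (T : measurableType d)
    (P : probability T R) (V : T -> R) (alpha beta gamma c K1 x1 K2 x2 : R) :
  1 < alpha -> 0 <= beta -> alpha < 1 + beta -> 1 + beta - alpha < gamma ->
  0 <= c -> 0 <= K1 -> 0 <= K2 -> measurable_fun setT V ->
  (forall x, x1 <= x -> `|fine (P [set t | V t > x]) - c / x `^ alpha|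
      <= K1 * x `^ (- (alpha + gamma))) ->
  (forall x, x2 <= x -> `|fine (P [set t | V t <= - x]) - c / x `^ alpha|
      <= K2 * x `^ (- (alpha + gamma))) ->
  stable_tails P alpha beta c V.
Proof.
move=> alpha1 beta0 ab bg c0 K10 K20 mV tail1 tail2.
have mV1 : measurable_fun setT (fun t => Num.max (V t) 0) by exact: measurable_maxr.
have mV2 : measurable_fun setT (fun t => Num.max (- V t) 0).
  by apply: measurable_maxr => //; exact: measurableT_comp.
have [t|x|C1 C10 HC1] := @tail_comparison_one_sided _ _ _ P _ false alpha beta gamma c K1
  (Num.max 1 x1) alpha1 beta0 ab bg c0 K10 mV1.
- by rewrite le_max lexx orbT.
- rewrite ge_max => /andP[x1' /tail1]; congr (`|fine (P _) - _| <= _).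
  apply/seteqP; split => t /=; rewrite lt_max; first by move=> ->.
  by case/orP => // /lt_trans-/(_ _ (lt_le_trans ltr01 x1')); rewrite ltxx.
have [t|x|C2 C20 HC2] := @tail_comparison_one_sided _ _ _ P _ true alpha beta gamma c K2
  (Num.max 1 x2) alpha1 beta0 ab bg c0 K20 mV2.
- by rewrite le_max lexx orbT.
- rewrite ge_max => /andP[x1' /tail2]; congr (`|fine (P _) - _| <= _).
  apply/seteqP; split => t /=; rewrite le_max lerNr; first by move=> ->.
  by case/orP => // /le_lt_trans-/(_ _ (lt_le_trans ltr01 x1')); rewrite ltxx.
exists (C1 + C2); first exact: addr_ge0.
move=> K G phi phi' [phi0 dphi cphi' phiG phiK].
have [|i1 j1 H1] := HC1 K G phi phi' phi0 dphi cphi' phiG.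
  by move=> x x0; rewrite -{2}(gtr0_norm x0).
pose phi2 x := phi (- x); pose phi2' x := - phi' (- x).
have dphi2 (x : R) : is_derive x 1 phi2 (phi2' x).
  have ? := dphi (- x).
  have -> : phi2 = phi \o -%R by [].
  by apply: is_derive_eq; rewrite mulrN1.
have [||||i2 j2 H2] := HC2 K G phi2 phi2' _ dphi2.
- by rewrite /phi2 oppr0.
- by move=> x; apply: continuousN; apply: continuous_comp; [exact: continuousN|exact: cphi'].
- by move=> x; rewrite normrN.
- by move=> x x0; rewrite normrN (le_trans (phiK _))// normrN gtr0_norm.
have -> : (fun t => phi (V t)) =
    (fun t => phi (Num.max (V t) 0) + phi2 (Num.max (- V t) 0)).
  apply/funext => t; rewrite /phi2; have [V0|V0] := leP (V t) 0.
    by rewrite max_l ?oppr_ge0// opprK phi0 add0r.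
  by rewrite max_r ?oppr0 ?phi0 ?addr0// oppr_le0 ltW.
rewrite RintegralD//.
rewrite /stable_pairing.
have -> : \int[mu]_(x in `]0, +oo[) ((phi' x - phi' (- x)) * (c / x `^ alpha)) =
  \int[mu]_(x in `]0, +oo[) (phi' x * (c / x `^ alpha)) +
  \int[mu]_(x in `]0, +oo[) (phi2' x * (c / x `^ alpha)).
  by rewrite -RintegralD//; apply: eq_Rintegral => x _; rewrite mulrDl.
rewrite opprD addrACA mulrDl; apply: le_trans (ler_normD _ _) _.
exact: lerD.
Qed.

(** Centering V moves phi (V) by at most |a| times a value of phi' near V, and
    |phi' x| <= K |x|^beta with beta <= 1 is integrable along V. *)
Lemma stable_tails_shift (d : measure_display) (T : measurableType d)
    (P : probability T R) (V : T -> R) (alpha beta c a : R) :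
  0 <= beta -> beta <= 1 -> P.-integrable setT (EFin \o V) ->
  stable_tails P alpha beta c V ->
  stable_tails P alpha beta c (fun t => V t - a).
Proof.
move=> beta0 beta1 iV [C C0 HC].
have iN : P.-integrable setT (EFin \o (fun t => `|V t|)) by exact: (integrable_norm iV).
pose W t := `|a| * (1 + `|V t| + `|a|).
have ic (k : R) : P.-integrable setT (EFin \o cst k).
  exact: finite_measure_integrable_cst.
have iW : P.-integrable setT (EFin \o W).
  apply: integrableZ_real => //; apply: integrableD_real => //; last exact: ic.
  by apply: integrableD_real => //; exact: ic.
have mV : measurable_fun setT V by apply/measurable_EFinP; case/integrableP: iV.
exists (C + \int[P]_t W t).
  by rewrite addr_ge0// Rintegral_ge0// => t _; rewrite /W mulr_ge0// addr_ge0.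
move=> K G phi phi' tc; have := HC _ _ _ _ tc; have [phi0 dphi cphi' phiG phiK] := tc.
have K0 : 0 <= K by have := phiK 1; rewrite normr1 powR1 mulr1; exact: le_trans.
have iVa : P.-integrable setT (EFin \o (fun t => V t - a)).
  by apply: integrableB_real => //; exact: ic.
have mphi : measurable_fun setT phi.
  apply: continuous_measurable_fun.
  exact: is_derive_continuous dphi.
have i1 := tail_class_integrable iVa tc.
have i2 := tail_class_integrable iV tc.
have H : `|\int[P]_t phi (V t - a) - \int[P]_t phi (V t)| <= (\int[P]_t W t) * K.
  rewrite -RintegralB// mulrC -RintegralZl//; apply: normr_Rintegral_le => //.
  - apply: measurable_funB; apply: measurableT_comp => //.
    exact: measurable_funB.
  - move=> t _; have [z] := mean_value (V t) (V t - a) dphi.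
    rewrite addrAC subrr sub0r normrN => za ->.
    rewrite normrM normrN /W mulrA mulrC (mulrC K) -!mulrA ler_wpM2l//.
    apply: le_trans (phiK z) _; apply: ler_wpM2l => //.
    apply: (@le_trans _ _ (1 + `|z|)); first exact: powR_le1D.
    rewrite -addrA lerD2l; have := ler_normD (z - V t) (V t); rewrite subrK.
    by move=> /le_trans; apply; rewrite [leRHS]addrC lerD2r.
  - exact: integrableZ_real.
move=> HV; rewrite mulrDl [leRHS]addrC.
have -> : \int[P]_t phi (V t - a) - stable_pairing alpha c phi' =
 (\int[P]_t phi (V t - a) - \int[P]_t phi (V t)) +
 (\int[P]_t phi (V t) - stable_pairing alpha c phi') by rewrite addrA subrK.
by apply: le_trans (ler_normD _ _) _; exact: lerD.
Qed.

End tail_comparison.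

(** * Homogeneity of the pairing with power tails *)

Section pairing_scaling.
Context {R : realType}.
Local Notation mu := (@lebesgue_measure R).

(** Infinite values are included, for the change of variables below to hold
    between divergent integrals as well. *)
Lemma gt0_muleBr_EFin (a : R) (x y : \bar R) : 0 < a ->
  (a%:E * (x - y) = a%:E * x - a%:E * y)%E.
Proof.
move=> a0; have a0' : (0 < a%:E)%E by rewrite lte_fin.
case: x y => [x||] [y||] /=; rewrite ?(gt0_muley a0') ?(gt0_muleNy a0') //=.
by rewrite -EFinD -!EFinM -EFinD mulrDr mulrN.
Qed.

Lemma fine_gt0_mule (a : R) (x : \bar R) : 0 < a -> fine (a%:E * x)%E = a * fine x.
Proof.
move=> a0; have a0' : (0 < a%:E)%E by rewrite lte_fin.
by case: x => [x||] //=; rewrite ?(gt0_muley a0') ?(gt0_muleNy a0')/= mulr0.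
Qed.

Lemma Rintegral_Zl_gt0 (D : set R) (k : R) (f : R -> R) : 0 < k -> measurable D ->
  measurable_fun D f ->
  \int[mu]_(x in D) (k * f x) = k * \int[mu]_(x in D) f x.
Proof.
move=> k0 mD mf.
have mEf : measurable_fun D (EFin \o f) by exact/measurable_EFinP.
rewrite /Rintegral -fine_gt0_mule//; congr fine.
under eq_integral do rewrite EFinM.
rewrite [in LHS]integralE [in RHS]integralE gt0_muleBr_EFin//.
rewrite (ge0_funeposM (EFin \o f) (ltW k0)) (ge0_funenegM (EFin \o f) (ltW k0)).
rewrite !ge0_integralZl ?lee_fin ?(ltW k0)//.
- exact: measurable_funeneg.
- exact: measurable_funepos.
Qed.

Lemma Rintegral_affine (b x0 : R) (f : R -> R) : 0 < b -> measurable_fun setT f ->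
  \int[mu]_x f x = b * \int[mu]_x f (b * x + x0).
Proof.
move=> b0 mf.
have mEf : measurable_fun setT (EFin \o f) by exact/measurable_EFinP.
have E g : measurable_fun setT g -> (forall x, 0 <= g x)%E ->
   (\int[mu]_x g x = b%:E * \int[mu]_x g (b * x + x0)%R)%E.
  by move=> mg g0; exact: ge0_integral_affine.
rewrite /Rintegral -fine_gt0_mule//; congr fine.
have -> : (\int[mu]_x (f (b * x + x0))%:E =
    \int[mu]_x (EFin \o f)^\+ (b * x + x0)%R - \int[mu]_x (EFin \o f)^\- (b * x + x0)%R)%E.
  rewrite -[LHS]/(\int[mu]_x ((EFin \o f) \o (fun x => b * x + x0)%R) x)%E integralE.
  by rewrite (funepos_comp (EFin \o f)) (funeneg_comp (EFin \o f)).
rewrite [in LHS]integralE gt0_muleBr_EFin//.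
by rewrite (E _ (measurable_funepos mEf))// (E _ (measurable_funeneg mEf)).
Qed.

(** k' = b k(b .) is the derivative of a dilated function, and the Lévy
    measure is homogeneous of degree - alpha. *)
Lemma stable_pairing_scale (alpha c b : R) (k : R -> R) : 0 < b -> continuous k ->
  stable_pairing alpha c (fun x => b * k (b * x)) = b `^ alpha * stable_pairing alpha c k.
Proof.
move=> b0 ck.
have mk : measurable_fun setT k by exact: continuous_measurable_fun.
pose g x := (k x - k (- x)) * (c / x `^ alpha).
have mg : measurable_fun setT g.
  apply: measurable_funM.
    by apply: measurable_funB => //; exact: measurableT_comp.
  exact: measurable_tail_weight.
pose D : set (measurableTypeR R) := `]0, +oo[%classic.
have mD : measurable D by exact: measurable_itv.
have mgD : measurable_fun setT (g \_ D).
  apply/(measurable_restrictT _ _).1 => //; exact: (measurable_funS _ _ mg).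
have -> : stable_pairing alpha c k = b * \int[mu]_(x in D) g (b * x).
  rewrite /stable_pairing -/D -[LHS]/(\int[mu]_(x in D) g x).
  rewrite [in LHS]Rintegral_mkcond (Rintegral_affine 0 b0)//; congr (_ * _).
  rewrite [RHS]Rintegral_mkcond; apply: eq_Rintegral => x _.
  by rewrite addr0 /patch !mem_setE !in_itv/= !andbT pmulr_rgt0.
rewrite /stable_pairing -/D.
have mgb : measurable_fun D (fun x => g (b * x)).
  by apply: measurable_funTS; apply: measurableT_comp => //; exact: measurable_funM.
rewrite mulrA -Rintegral_Zl_gt0// ?mulr_gt0 ?powR_gt0//.
apply: eq_Rintegral => x; rewrite inE /D/= in_itv/= andbT => x0.
rewrite /g mulrN powRM ?ltW// invfM -mulrBr.
have ? : b `^ alpha != 0 by rewrite gt_eqF// powR_gt0.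
have ? : x `^ alpha != 0 by rewrite gt_eqF// powR_gt0.
by field; apply/andP; split.
Qed.

End pairing_scaling.

(** * Test functions with a Hölder derivative *)

Section function_classes.
Context {R : realType}.

Definition bounded_lipschitz (M L : R) (f : R -> R) :=
  (forall x, `|f x| <= M) /\ (forall x y, `|f x - f y| <= L * `|x - y|).

(** The class Lambda_(1 + beta) with the derivative g exhibited: averaging f
    averages g, so the pair is carried along without differentiating under
    the integral sign. *)
Definition holder_derivative (beta G : R) (f g : R -> R) :=
  [/\ (forall x : R, is_derive x 1 f (g x)), (forall x, `|g x| <= G) &
      (forall x y, `|g x - g y| <= `|x - y| `^ beta)].

Lemma bounded_lipschitz_continuous M L f : bounded_lipschitz M L f -> continuous f.
Proof.
move=> [_ fL] x; apply/cvgrPdist_le => e e0.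
near=> y; apply: le_trans (fL _ _) _.
have L0 : 0 <= `|L| by [].
apply: (@le_trans _ _ ((1 + `|L|) * `|x - y|)).
  by apply: ler_wpM2r => //; rewrite (le_trans (ler_norm _))// lerDr.
rewrite mulrC -ler_pdivlMr ?ltr_pwDl//.
near: y; apply: (@cvgr_dist_le _ _ _ _ (nbhs_filter x) id x) => //.
by rewrite divr_gt0// ltr_pwDl.
Unshelve. all: by end_near. Qed.

Lemma holder_continuous (beta : R) g : 0 < beta ->
  (forall x y : R, `|g x - g y| <= `|x - y| `^ beta) -> continuous (g : R -> R).
Proof.
move=> b0 gH x; apply/cvgrPdist_le => e e0.
near=> y; apply: le_trans (gH _ _) _.
have -> : e = (e `^ beta^-1) `^ beta by rewrite -powRrM mulVf ?gt_eqF// powRr1// ltW.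
rewrite ge0_ler_powR ?nnegrE ?powR_ge0 ?(ltW b0)//; apply: ltW.
near: y; apply: (@cvgr_dist_lt _ _ _ _ (nbhs_filter x) id x) => //.
by rewrite powR_gt0.
Unshelve. all: by end_near. Qed.

Lemma holder_derivative_lipschitz beta G f g x y :
  holder_derivative beta G f g -> `|f x - f y| <= G * `|x - y|.
Proof.
by move=> [df gG _]; have [z _ ->] := mean_value y x df; rewrite normrM ler_wpM2r.
Qed.

Lemma holder_derivative_taylor beta G f g x h : 0 < beta ->
  holder_derivative beta G f g ->
  `|f (x + h) - f x - h * g x| <= `|h| * `|h| `^ beta.
Proof.
move=> b0 [df _ gH].
pose k u := f u - u * g x.
have dk (u : R) : is_derive u 1 k (g u - g x).
  have ? := df u.
  have -> : k = f - (g x) \*: (id : R -> R) by apply/funext => v; rewrite /k /= mulrC.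
  by apply: is_derive_eq; rewrite -[_ *: _]/(_ * _) mulr1.
have [z zx E] := mean_value x (x + h) dk.
have -> : f (x + h) - f x - h * g x = k (x + h) - k x by rewrite /k; ring.
rewrite E addrAC subrr add0r normrM mulrC ler_wpM2l//.
apply: le_trans (gH _ _) _; rewrite ge0_ler_powR ?nnegrE ?(ltW b0)//.
by rewrite (le_trans zx)// addrAC subrr add0r.
Qed.

(** A uniform first-order estimate passes through an expectation, and by this
    converse it yields the derivative of the averaged function. *)
Lemma is_derive_of_taylor (beta : R) (f g : R -> R) (x : R) : 0 < beta ->
  (forall h, `|f (x + h) - f x - h * g x| <= `|h| * `|h| `^ beta) ->
  is_derive x 1 f (g x).
Proof.
move=> b0 H.
suff C : h^-1 *: (f (h + x) - f x) @[h --> 0^'] --> g x.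
  apply: DeriveDef.
    apply/cvg_ex; exists (g x).
    by under eq_fun do rewrite /= -[_ *: 1]/(_ * 1) mulr1; exact: C.
  rewrite /derive; apply: cvg_lim => //.
  by under eq_fun do rewrite /= -[_ *: 1]/(_ * 1) mulr1; exact: C.
apply/cvgrPdist_le => e e0.
near=> h.
have h0 : h != 0 by near: h; exact: nbhs_dnbhs_neq.
rewrite -[_ *: _]/(_ * _).
have -> : g x - h^-1 * (f (h + x) - f x) = - (h^-1 * (f (x + h) - f x - h * g x)).
  by rewrite (addrC h); field.
rewrite normrN normrM normfV ler_pdivrMl ?normr_gt0//.
apply: le_trans (H h) _; rewrite ler_wpM2l//.
have -> : e = (e `^ beta^-1) `^ beta by rewrite -powRrM mulVf ?gt_eqF// powRr1// ltW.
rewrite ge0_ler_powR ?nnegrE ?powR_ge0 ?(ltW b0)//; apply: ltW.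
near: h; apply: dnbhs0_lt; exact: powR_gt0.
Unshelve. all: by end_near. Qed.

(** The powers are split as 1 in y and beta in z: for independent y and z with
    finite first moment the right-hand side is integrable, whereas
    |X|^(1 + beta) need not be. *)
Lemma holder_derivative_second_difference beta G f g x y z : 0 < beta ->
  holder_derivative beta G f g ->
  `|f (x + y + z) - f (x + y) - (f (x + z) - f x)| <= `|y| * `|z| `^ beta.
Proof.
move=> b0 [df _ gH].
pose k u := f (u + z) - f u.
have dk (u : R) : is_derive u 1 k (g (u + z) - g u).
  have ? := df u; have ? := df (u + z).
  have -> : k = (f \o (fun v => v + z)) - f by [].
  by apply: is_derive_eq; rewrite addr0 mulr1.
have [w _ E] := mean_value x (x + y) dk.
rewrite -[X in `|X|]/(k (x + y) - k x) E addrAC subrr add0r normrM mulrC ler_wpM2l//.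
by apply: le_trans (gH _ _) _; rewrite addrAC subrr add0r.
Qed.

End function_classes.

(** * The averaging operator and the dyadic step *)

Section smear.
Context {R : realType} {d : measure_display} {T : measurableType d}.
Variables (P : probability T R) (X : T -> R).
Hypothesis iX : P.-integrable setT (EFin \o X).

(** Adding an independent copy of a X to the argument and averaging; the n-th
    iterate adds n independent copies. *)
Definition smear (a : R) (f : R -> R) (x : R) : R := \int[P]_t f (x + a * X t).

Let mX : measurable_fun setT X.
Proof. by apply/measurable_EFinP; case/integrableP: iX. Qed.

Let iabsX : P.-integrable setT (EFin \o (fun t => `|X t|)).
Proof. exact: (integrable_norm iX). Qed.

Lemma integrable_cst_prob (k : R) : P.-integrable setT (EFin \o (fun=> k)).
Proof. exact: finite_measure_integrable_cst. Qed.

Lemma Rintegral_cst_prob (k : R) : \int[P]_t k = k.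
Proof.
rewrite Rintegral_cst//; transitivity (k * fine (1 : \bar R)%E); last by rewrite mulr1.
by congr (_ * fine _); exact: probability_setT.
Qed.

Lemma measurable_shifted (a x : R) (f : R -> R) : continuous f ->
  measurable_fun setT (fun t => f (x + a * X t)).
Proof.
move=> cf; apply: measurableT_comp; first exact: continuous_measurable_fun.
by apply: measurable_funD => //; exact: measurable_funM.
Qed.

Lemma integrable_shifted (a x M : R) (f : R -> R) : continuous f ->
  (forall y, `|f y| <= M) -> P.-integrable setT (EFin \o (fun t => f (x + a * X t))).
Proof.
move=> cf fM; apply: (@integrable_le _ _ _ P _ _ (fun=> M)) => //.
  exact: measurable_shifted.
exact: integrable_cst_prob.
Qed.

Lemma normr_smearB_le (a x y e M1 M2 : R) (f1 f2 : R -> R) :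
  continuous f1 -> continuous f2 ->
  (forall y, `|f1 y| <= M1) -> (forall y, `|f2 y| <= M2) ->
  (forall h, `|f1 (x + h) - f2 (y + h)| <= e) -> `|smear a f1 x - smear a f2 y| <= e.
Proof.
move=> c1 c2 b1 b2 H; rewrite /smear.
have i1 := integrable_shifted a x c1 b1; have i2 := integrable_shifted a y c2 b2.
rewrite -RintegralB// -[leRHS]Rintegral_cst_prob.
apply: normr_Rintegral_le => //.
  by apply: measurable_funB; exact: measurable_shifted.
exact: integrable_cst_prob.
Qed.

Lemma normr_smear_le (a x M : R) f : continuous f -> (forall y, `|f y| <= M) ->
  `|smear a f x| <= M.
Proof.
move=> cf fM; rewrite -[leRHS]Rintegral_cst_prob; apply: normr_Rintegral_le => //.
  exact: measurable_shifted.
exact: integrable_cst_prob.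
Qed.

Lemma bounded_lipschitz_smear a M L f :
  bounded_lipschitz M L f -> bounded_lipschitz M L (smear a f).
Proof.
move=> fML; have [fM fL] := fML; have cf := bounded_lipschitz_continuous fML.
split; first by move=> x; exact: normr_smear_le.
move=> x y; apply: (@normr_smearB_le _ _ _ _ M M) => // h.
by apply: le_trans (fL _ _) _; rewrite opprD addrACA subrr addr0.
Qed.

Lemma smear_contract a M1 L1 M2 L2 e f1 f2 :
  bounded_lipschitz M1 L1 f1 -> bounded_lipschitz M2 L2 f2 ->
  (forall x, `|f1 x - f2 x| <= e) ->
  forall x, `|smear a f1 x - smear a f2 x| <= e.
Proof.
move=> b1 b2 H x.
by apply: (@normr_smearB_le _ _ _ _ M1 M2); [exact: bounded_lipschitz_continuous b1|
  exact: bounded_lipschitz_continuous b2|exact: b1.1|exact: b2.1|].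
Qed.

Lemma holder_derivative_smear a beta M G f g : 0 < beta ->
  (forall x, `|f x| <= M) -> holder_derivative beta G f g ->
  holder_derivative beta G (smear a f) (smear a g).
Proof.
move=> b0 fM fg; have [df gG gH] := fg.
have cg := holder_continuous b0 gH.
have cf := is_derive_continuous df.
split; last 2 first.
- by move=> x; exact: normr_smear_le.
- move=> x y; apply: (@normr_smearB_le _ _ _ _ G G) => // h.
  by apply: le_trans (gH _ _) _; rewrite opprD addrACA subrr addr0.
move=> x; apply: (is_derive_of_taylor b0) => h; rewrite /smear.
have i1 y := integrable_shifted a y cf fM; have i2 y := integrable_shifted a y cg gG.
rewrite -RintegralZl// -RintegralB// -RintegralB//; last 2 first.
- exact: integrableB_real.
- exact: integrableZ_real.
rewrite -[leRHS]Rintegral_cst_prob; apply: normr_Rintegral_le => //.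
- by repeat apply: measurable_funB; do ?[exact: measurable_shifted];
    apply: measurable_funM => //; exact: measurable_shifted.
- by move=> t _; rewrite (addrAC x h); exact: (holder_derivative_taylor _ _ b0 fg).
- exact: integrable_cst_prob.
Qed.

Hypothesis X0 : \int[P]_t X t = 0.

Section first_order_remainder.
Variables (beta G M : R) (h g : R -> R).
Hypotheses (b0 : 0 < beta) (hM : forall x, `|h x| <= M)
  (hg : holder_derivative beta G h g).

Lemma tail_class_remainder (a x : R) : 0 < a ->
  tail_class beta (a * a `^ beta) (a * (G + G))
    (fun y => h (x + a * y) - h x - a * y * g x) (fun y => a * (g (x + a * y) - g x)).
Proof.
move=> a0; have [dh gG gH] := hg; have cg := holder_continuous b0 gH.
split.
- by rewrite mulr0 mul0r addr0 subrr subr0.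
- move=> y; have ? := dh (x + a * y).
  have -> : (fun y => h (x + a * y) - h x - a * y * g x) =
    (h \o (fun y => x + a * y)) - cst (h x) - (a * g x) \*: id.
    by apply/funext => z; rewrite /= mulrAC.
  apply: is_derive_eq; rewrite /GRing.scale /=; ring.
- move=> y; apply: cvgM; first exact: cvg_cst.
  apply: cvgB; last exact: cvg_cst.
  apply: (@continuous_comp _ _ _ (fun y => x + a * y) g); last exact: cg.
  by apply: cvgD; [exact: cvg_cst|apply: cvgM; [exact: cvg_cst|exact: cvg_id]].
- move=> y; rewrite normrM gtr0_norm// ler_wpM2l ?(ltW a0)//.
  by rewrite (le_trans (ler_normB _ _))// lerD.
- move=> y; rewrite normrM gtr0_norm// -mulrA ler_wpM2l ?(ltW a0)//.
  apply: le_trans (gH _ _) _; rewrite addrAC subrr add0r normrM (gtr0_norm a0).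
  by rewrite powRM// ltW.
Qed.

(** The linear term of the Taylor remainder integrates to 0 because X is
    centered. *)
Lemma smear_first_order (a x : R) : 0 < a ->
  \int[P]_t (h (x + a * X t) - h x - a * X t * g x) = smear a h x - h x.
Proof.
move=> a0; have [dh gG gH] := hg.
have ch := is_derive_continuous dh.
have i1 := integrable_shifted a x ch hM.
have ic := integrable_cst_prob.
have i2 : P.-integrable setT (EFin \o (fun t => (a * g x) * X t)).
  exact: integrableZ_real.
under eq_Rintegral do rewrite mulrAC.
rewrite RintegralB//; last exact: integrableB_real.
by rewrite RintegralB// RintegralZl// X0 mulr0 subr0 Rintegral_cst_prob.
Qed.

End first_order_remainder.

(** One summand of scale a against two summands of scale a b.  The double
    average equals 2 T h - h, for T = smear (a b), up to a second difference;
    then h + E phi (a X) and h + 2 E phi (a b X) are both h plus the same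
    pairing, by homogeneity and 2 b^alpha = 1, up to O(a^(1 + beta)). *)
Lemma dyadic_step (alpha beta c b : R) : 0 < alpha -> 0 < beta -> beta <= 1 ->
  0 < b -> b <= 1 -> 2 * b `^ alpha = 1 ->
  stable_tails P alpha beta c X ->
  exists2 C, 0 <= C & forall a M G h g, 0 < a ->
    (forall x, `|h x| <= M) -> holder_derivative beta G h g ->
    forall x, `|smear a h x - smear (a * b) (smear (a * b) h) x| <= C * (a * a `^ beta).
Proof.
move=> al0 b0 b1 bb0 bb1 bal [C C0 HC].
pose m1 := \int[P]_t (1 + `|X t|).
pose m2 := \int[P]_t `|X t|.
have m10 : 0 <= m1 by apply: Rintegral_ge0 => t _; exact: addr_ge0.
have m20 : 0 <= m2 by apply: Rintegral_ge0.
exists (C + (C + C) + m1 * m2); first by rewrite !addr_ge0// mulr_ge0.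
move=> a M G h g a0 hM hg x.
have [dh gG gH] := hg; have cg := holder_continuous b0 gH.
have ch := is_derive_continuous dh.
set D := a * a `^ beta.
have D0 : 0 <= D by rewrite mulr_ge0 ?powR_ge0// ltW.
have ab0 : 0 < a * b by rewrite mulr_gt0.
have Dle : (a * b) * (a * b) `^ beta <= D.
  rewrite powRM ?(ltW a0) ?(ltW bb0)// mulrACA -[leRHS]mulr1 ler_wpM2l//.
  rewrite -[leRHS]mulr1 ler_pM ?powR_ge0// ?(ltW bb0)//.
  have <- : 1 `^ beta = 1 :> R by rewrite powR1.
  by rewrite ge0_ler_powR ?nnegrE ?(ltW bb0) ?(ltW b0).
have E1 := HC _ _ _ _ (tail_class_remainder b0 hg x a0).
have E2 := HC _ _ _ _ (tail_class_remainder b0 hg x ab0).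
rewrite (smear_first_order hM hg)// in E1.
rewrite (smear_first_order hM hg)// in E2.
set p := stable_pairing alpha c _ in E1.
(* The main terms cancel because 2 b^alpha = 1. *)
have Ep : 2 * stable_pairing alpha c (fun y => a * b * (g (x + a * b * y) - g x)) = p.
  pose k y := a * (g (x + a * y) - g x).
  have -> : (fun y => a * b * (g (x + a * b * y) - g x)) = (fun y => b * k (b * y)).
    by apply/funext => y; rewrite /k mulrA (mulrC b) !mulrA.
  rewrite stable_pairing_scale// ?mulrA ?bal ?mul1r//.
  by have [] := tail_class_remainder b0 hg x a0.
have hab : (forall y, `|smear (a * b) h y| <= M) by move=> y; exact: normr_smear_le.
have chab : continuous (smear (a * b) h).
  have [dh' _ _] := holder_derivative_smear (a * b) b0 hM hg.
  exact: is_derive_continuous dh'.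
(* The second difference of h, averaged over two independent copies. *)
have E3 : `|smear (a * b) (smear (a * b) h) x - smear (a * b) h x -
      (smear (a * b) h x - h x)| <= m1 * m2 * D.
  have -> : smear (a * b) (smear (a * b) h) x - smear (a * b) h x -
      (smear (a * b) h x - h x) =
    \int[P]_t (smear (a * b) h (x + a * b * X t) - h (x + a * b * X t) -
       (smear (a * b) h x - h x)).
    have ii1 := integrable_shifted (a * b) x chab hab.
    have ii2 := integrable_shifted (a * b) x ch hM.
    rewrite RintegralB//; last 2 first.
    - exact: integrableB_real.
    - exact: integrable_cst_prob.
    by rewrite RintegralB// Rintegral_cst_prob.
  apply: (@le_trans _ _ (\int[P]_t (m1 * D * `|X t|))); last first.
    by rewrite RintegralZl// -/m2 mulrAC.
  apply: normr_Rintegral_le => //.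
  - by apply: measurable_funB => //; apply: measurable_funB; exact: measurable_shifted.
  - move=> t _.
    have -> : smear (a * b) h (x + a * b * X t) - h (x + a * b * X t) -
       (smear (a * b) h x - h x) =
      \int[P]_s (h (x + a * b * X t + a * b * X s) - h (x + a * b * X t) -
         (h (x + a * b * X s) - h x)).
      have jj1 y := integrable_shifted (a * b) y ch hM.
      have jc := integrable_cst_prob.
      rewrite RintegralB//; [|exact: integrableB_real..].
      by rewrite !RintegralB// !Rintegral_cst_prob.
    apply: (@le_trans _ _ (\int[P]_s (D * `|X t| * (1 + `|X s|)))); last first.
      rewrite RintegralZl//; first by rewrite -/m1 mulrC mulrA.
      by apply: integrableD_real => //; exact: integrable_cst_prob.
    apply: normr_Rintegral_le => //.
    + by apply: measurable_funB; apply: measurable_funB => //; exact: measurable_shifted.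
    + move=> s _; apply: le_trans (holder_derivative_second_difference _ _ _ b0 hg) _.
      rewrite !(normrM (a * b)) (gtr0_norm ab0) powRM ?(ltW ab0)// mulrACA -[leRHS]mulrA.
      apply: ler_pM => //; do ?[by rewrite mulr_ge0// ?powR_ge0// ltW].
      by rewrite ler_wpM2l// powR_le1D// ltW.
    + apply: integrableZ_real => //; apply: integrableD_real => //.
      exact: integrable_cst_prob.
  - exact: integrableZ_real.
have {}E2 := le_trans E2 (ler_wpM2l C0 Dle).
rewrite -/D in E1; rewrite !mulrDl.
move: E1 E2 E3; rewrite -Ep !ler_norml => /andP[? ?] /andP[? ?] /andP[? ?].
by apply/andP; split; lra.
Qed.

End smear.

(** * Telescoping and summation over dyadic scales *)

Section telescoping.
Context {R : realType}.

(** Lindeberg's replacement of one summand at a time: A contracts the uniform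
    norm, hence the error of each of the n replacements is not amplified.  D
    is the class on which A contracts and S the smaller class, stable under B,
    on which a single replacement is estimated. *)
Lemma normr_iterB_le (A B : (R -> R) -> R -> R) (D S : (R -> R) -> Prop) (e : R) :
  (forall f, D f -> D (A f)) -> (forall f, S f -> S (B f)) ->
  (forall f, S f -> D f) ->
  (forall e f1 f2, D f1 -> D f2 -> (forall x, `|f1 x - f2 x| <= e) ->
     forall x, `|A f1 x - A f2 x| <= e) ->
  (forall f, S f -> forall x, `|A f x - B f x| <= e) ->
  forall n f, S f -> forall x, `|iter n A f x - iter n B f x| <= n%:R * e.
Proof.
move=> DA SB SD contract step; elim => [|n IH] f Sf x.
  by rewrite subrr normr0 mul0r.
have Dn : D (iter n A f) by elim: n {IH} => [|n]; [exact: SD|exact: DA].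
have Sn : S (iter n B f) by elim: n {IH Dn} => [|n]; [by []|exact: SB].
rewrite !iterS; apply: le_trans (ler_distD (A (iter n B f) x) _ _) _.
rewrite -natr1 mulrDl mul1r; apply: lerD; last exact: step.
apply: contract => //; first exact: SD.
exact: IH.
Qed.

Lemma iter_mul2 (T : Type) (A : T -> T) n x : iter (2 * n) A x = iter n (A \o A) x.
Proof. by elim: n => // n IH; rewrite mulnS iterS /= IH. Qed.

End telescoping.

Section dyadic_chain.
Context {R : realType} {d : measure_display} {T : measurableType d}.
Variables (P : probability T R) (X : T -> R).
Hypotheses (iX : P.-integrable setT (EFin \o X)) (X0 : \int[P]_t X t = 0).
Variables (alpha beta c : R).
Hypotheses (al1 : 1 < alpha) (b0 : 0 < beta) (b1 : beta <= 1)
  (ab : alpha < 1 + beta) (HX : stable_tails P alpha beta c X).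

Definition scale_step (N : nat) : R := N%:R `^ (- alpha^-1).

Definition smeared_sum (N : nat) (f : R -> R) : R :=
  iter N (smear P X (scale_step N)) f 0.

Let al0 : 0 < alpha. Proof. exact: lt_trans al1. Qed.

Lemma scale_step_gt0 N : (0 < N)%N -> 0 < scale_step N.
Proof. by move=> N0; rewrite powR_gt0// ltr0n. Qed.

Lemma scale_step_double N : scale_step (2 * N) = scale_step N * 2 `^ (- alpha^-1).
Proof. by rewrite /scale_step natrM powRM// mulrC. Qed.

Lemma scale_step_rate N : (0 < N)%N ->
  N%:R * (scale_step N * scale_step N `^ beta) = N%:R `^ ((alpha - (1 + beta)) / alpha).
Proof.
move=> N0; have N0' : (N%:R : R) != 0 by rewrite pnatr_eq0 -lt0n.
rewrite /scale_step -powRrM -[X in X * _](@powRr1 _ N%:R)//.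
rewrite -!powRD ?N0' ?implybT//; congr (_ `^ _).
by field; rewrite gt_eqF.
Qed.

Let kappa := (alpha - (1 + beta)) / alpha.

(** N replacements, each of cost a_N^(1 + beta) with a_N = N^(- 1 / alpha). *)
Lemma smeared_sum_double : exists2 C, 0 <= C & forall N M G h g, (0 < N)%N ->
  (forall x, `|h x| <= M) -> holder_derivative beta G h g ->
  `|smeared_sum N h - smeared_sum (2 * N) h| <= C * N%:R `^ kappa.
Proof.
have [|||C C0 HC] := @dyadic_step _ _ _ P X iX X0 alpha beta c
  (2 `^ (- alpha^-1)) al0 b0 b1 _ _ _ HX.
- by rewrite powR_gt0.
- by rewrite powRN invf_le1 ?powR_gt0// -{1}(powRr0 2) ler_powR ?ler1n// invr_ge0 ltW.
- by rewrite -powRrM mulNr mulVf ?gt_eqF// powRN powRr1// mulfV.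
exists C => // N M G h g N0 hM hg.
rewrite /smeared_sum iter_mul2 scale_step_double.
set a := scale_step N; have a0 : 0 < a by exact: scale_step_gt0.
apply: (@le_trans _ _ (N%:R * (C * (a * a `^ beta)))); last first.
  by rewrite mulrCA scale_step_rate.
pose S f := exists g, (forall x, `|f x| <= M) /\ holder_derivative beta G f g.
apply: (@normr_iterB_le _ _ _ (bounded_lipschitz M G) S) => //.
- by move=> f; exact: bounded_lipschitz_smear.
- move=> f [g' [fM fg]].
  pose s := a * 2 `^ (- alpha^-1).
  have sM y : `|smear P X s f y| <= M.
    have [df _ _] := fg; apply: normr_smear_le => //.
    exact: is_derive_continuous df.
  have sg := holder_derivative_smear iX s b0 fM fg.
  exists (smear P X s (smear P X s g')); split; last first.
    exact: (holder_derivative_smear iX s b0 sM sg).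
  have [df _ _] := sg; move=> y; apply: normr_smear_le => //.
  exact: is_derive_continuous df.
- move=> f [g' [fM fg]]; split => // x y; exact: (holder_derivative_lipschitz _ _ fg).
- move=> e f1 f2 D1 D2; move=> H; exact: (smear_contract iX _ D1 D2 H).
- by move=> f [g' [fM fg]] x; exact: (HC _ _ _ _ _ a0 fM fg).
- by exists g.
Qed.

(** The doubling errors at N, 2 N, 4 N, ... form a geometric series of ratio
    2^kappa < 1, since kappa < 0 when alpha < 1 + beta. *)
Lemma smeared_sum_dyadic : exists2 C, 0 <= C & forall j N M G h g, (0 < N)%N ->
  (forall x, `|h x| <= M) -> holder_derivative beta G h g ->
  `|smeared_sum N h - smeared_sum (2 ^ j * N) h| <= C * N%:R `^ kappa.
Proof.
have [C C0 HC] := smeared_sum_double.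
pose rho : R := 2 `^ kappa.
have kappa0 : kappa < 0 by rewrite pmulr_llt0 ?invr_gt0// subr_lt0.
have rho1 : rho < 1.
  by rewrite /rho /powR pnatr_eq0/= expR_lt1 nmulr_rlt0// ln_gt0// ltr1n.
have rho0 : 0 <= rho by exact: powR_ge0.
have r10 : 0 < 1 - rho by rewrite subr_gt0.
exists (C / (1 - rho)); first by rewrite divr_ge0// ltW.
move=> j N M G h g N0 hM hg.
suff H : `|smeared_sum N h - smeared_sum (2 ^ j * N) h| <=
    C * N%:R `^ kappa * ((1 - rho ^+ j) / (1 - rho)).
  apply: le_trans H _; rewrite -!mulrA ler_wpM2l// mulrC ler_wpM2r ?powR_ge0//.
  by rewrite ler_pdivrMr// mulVf ?gt_eqF// gerBl exprn_ge0.
elim: j => [|j IH]; first by rewrite expn0 mul1n subrr normr0 expr0 subrr mul0r mulr0.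
apply: le_trans (ler_distD (smeared_sum (2 ^ j * N) h) _ _) _.
apply: le_trans (lerD IH _) _.
  rewrite expnS -mulnA; apply: (HC _ _ _ _ _ _ hM hg).
  by rewrite muln_gt0 expn_gt0 N0.
have -> : (2 ^ j * N)%:R `^ kappa = N%:R `^ kappa * rho ^+ j.
  rewrite natrM powRM// mulrC; congr (_ * _).
  by rewrite natrX -powR_mulrn// -powRrM mulrC powRrM powR_mulrn// powR_ge0.
rewrite exprS le_eqVlt; apply/orP; left; apply/eqP.
by field; rewrite gt_eqF.
Qed.

End dyadic_chain.

(** * The limit of the cosine transforms *)

Section trigonometric_bounds.
Context {R : realType}.

Lemma sin_lipschitz (x y : R) : `|sin x - sin y| <= `|x - y|.
Proof.
have [z _ ->] := @mean_value R sin cos y x (fun x => is_derive_sin x).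
by rewrite normrM -[leRHS]mul1r ler_wpM2r// ler_norml cos_geN1 cos_le1.
Qed.

Lemma cos_lipschitz (x y : R) : `|cos x - cos y| <= `|x - y|.
Proof.
have [z _ ->] := @mean_value R cos (fun x => - sin x) y x (fun x => is_derive_cos x).
by rewrite normrM -[leRHS]mul1r ler_wpM2r// normrN ler_norml sin_geN1 sin_le1.
Qed.

Lemma normr_cos_le1 (x : R) : `|cos x| <= 1.
Proof. by rewrite ler_norml cos_geN1 cos_le1. Qed.

Lemma normr_sin_le1 (x : R) : `|sin x| <= 1.
Proof. by rewrite ler_norml sin_geN1 sin_le1. Qed.

(** Interpolates between the Lipschitz bound and the bound by 2. *)
Lemma sin_holder (beta x y : R) : 0 <= beta -> beta <= 1 ->
  `|sin x - sin y| <= 2 * `|x - y| `^ beta.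
Proof.
move=> b0 b1; have [h1|/ltW h1] := leP `|x - y| 1.
  apply: le_trans (sin_lipschitz _ _) _.
  have [->|h0] := eqVneq (x - y) 0; first by rewrite normr0 mulr_ge0// powR_ge0.
  rewrite -[leLHS]mul1r ler_pM// ?ler1n// ger1_powR// h1 andbT.
  by rewrite normr_gt0.
apply: le_trans (ler_normB _ _) _.
apply: (@le_trans _ _ 2); first by rewrite (natrD _ 1 1) lerD// normr_sin_le1.
rewrite -[leLHS]mulr1 ler_wpM2l// -{1}(powRr0 `|x - y|).
exact: ler_powR.
Qed.

Lemma expR_second_order (s : R) : s <= 0 -> `|1 + s - expR s| <= s ^+ 2.
Proof.
move=> s0; rewrite ler_norml; apply/andP; split; last first.
  by rewrite (@le_trans _ _ 0) ?sqr_ge0// subr_le0 expR_ge1Dx.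
have h : expR s <= (1 - s)^-1.
  rewrite -[s in expR s]opprK expRN lef_pV2 ?posrE ?expR_gt0//; last by lra.
  exact: expR_ge1Dx.
suff : (1 - s)^-1 <= 1 + s + s ^+ 2 by move: h; lra.
rewrite -[leLHS]mul1r ler_pdivrMr; last by lra.
have -> : (1 + s + s ^+ 2) * (1 - s) = 1 - s ^+ 3 by ring.
by rewrite lerDl oppr_ge0 exprS mulr_le0_ge0// sqr_ge0.
Qed.

End trigonometric_bounds.

Section cosine_limit.
Context {R : realType} {d : measure_display} {T : measurableType d}.
Variables (P : probability T R) (X : T -> R).
Hypotheses (iX : P.-integrable setT (EFin \o X)) (X0 : \int[P]_t X t = 0).
Variables (alpha beta c : R).
Hypotheses (al1 : 1 < alpha) (b0 : 0 < beta) (b1 : beta <= 1)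
  (ab : alpha < 1 + beta) (HX : stable_tails P alpha beta c X).
Local Notation mu := (@lebesgue_measure R).

Let al0 : 0 < alpha. Proof. exact: lt_trans al1. Qed.

Lemma tail_class_pairing_integrable K G phi phi' :
  tail_class beta K G phi phi' ->
  mu.-integrable `]0, +oo[ (EFin \o (fun x => (phi' x - phi' (- x)) * (c / x `^ alpha))).
Proof.
move=> [_ _ cphi' phiG phiK].
have mphi : measurable_fun setT phi' by exact: continuous_measurable_fun.
apply: (@integrable_two_powers _ _ 1 ((K + K) * `|c|) ((G + G) * `|c|)
  (beta - alpha) (- alpha)) => //.
- apply: measurable_funM; last exact: measurable_tail_weight.
  by apply: measurable_funB => //; exact: measurableT_comp.
- by move: ab; lra.
- by rewrite ltrN2.
- move=> x x0 _; rewrite normrM -gt0_powR_div// normrM normfV (ger0_norm (powR_ge0 _ _)).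
  rewrite mulrACA; apply: ler_pM => //; first by rewrite mulr_ge0// invr_ge0 powR_ge0.
  rewrite mulrDl; apply: le_trans (ler_normB _ _) _.
  by apply: lerD; apply: le_trans (phiK _) _; rewrite ?normrN (gtr0_norm x0).
- move=> x _; rewrite normrM powRN normrM normfV (ger0_norm (powR_ge0 _ _)) -mulrA.
  apply: ler_wpM2r; first by rewrite mulr_ge0// invr_ge0 powR_ge0.
  by apply: le_trans (ler_normB _ _) _; exact: lerD.
Qed.

(** The Lévy exponent of the symmetric stable law, integrated by parts. *)
Definition cosine_symbol (u : R) : R :=
  stable_pairing alpha c (fun x => - u * sin (u * x)).

Lemma cosine_symbol_scale a u : 0 < a ->
  cosine_symbol (u * a) = a `^ alpha * cosine_symbol u.
Proof.
move=> a0; rewrite /cosine_symbol -stable_pairing_scale//.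
  congr stable_pairing; apply/funext => x.
  by rewrite !mulrA; congr (_ * _); ring.
move=> x; apply: cvgM; first exact: cvg_cst.
apply: continuous_comp; last exact: continuous_sin.
by apply: cvgM; [exact: cvg_cst|exact: cvg_id].
Qed.

(** The Taylor remainder of cos (u y + e) at y = 0.  The phase e is arbitrary
    because the cosine is averaged at all points, not only at 0. *)
Lemma tail_class_cosine (u e : R) : 0 < u ->
  tail_class beta (2 * (u * u `^ beta)) (u * 2)
    (fun y => cos (u * y + e) - cos e + u * y * sin e)
    (fun y => - u * (sin (u * y + e) - sin e)).
Proof.
move=> u0; split.
- by rewrite mulr0 add0r subrr mul0r addr0.
- move=> y.
  have -> : (fun y => cos (u * y + e) - cos e + u * y * sin e) =
    (cos \o (fun y => u * y + e)) - cst (cos e) + (u * sin e) \*: id.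
    by apply/funext => z; rewrite /= mulrAC.
  apply: is_derive_eq; rewrite /GRing.scale /=; ring.
- move=> y; apply: cvgM; first exact: cvg_cst.
  apply: cvgB; last exact: cvg_cst.
  apply: continuous_comp; last exact: continuous_sin.
  by apply: cvgD; [apply: cvgM; [exact: cvg_cst|exact: cvg_id]|exact: cvg_cst].
- move=> y; rewrite normrM normrN (gtr0_norm u0) ler_wpM2l ?(ltW u0)//.
  apply: le_trans (ler_normB _ _) _.
  by rewrite (natrD _ 1 1) lerD// normr_sin_le1.
- move=> y; rewrite normrM normrN (gtr0_norm u0).
  apply: (@le_trans _ _ (u * (2 * `|u * y| `^ beta))).
    rewrite ler_wpM2l ?(ltW u0)//.
    by rewrite -[in leRHS](addrK e (u * y)) sin_holder// ltW.
  rewrite normrM (gtr0_norm u0) powRM// ?(ltW u0)//.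
  by rewrite le_eqVlt; apply/orP; left; apply/eqP; ring.
Qed.

(** The part of the derivative that is even in y does not see symmetric tails,
    so the phase factors out as cos e. *)
Lemma stable_pairing_cosine (u e : R) : 0 < u ->
  stable_pairing alpha c (fun y => - u * (sin (u * y + e) - sin e)) =
  cosine_symbol u * cos e.
Proof.
move=> u0; rewrite /cosine_symbol /stable_pairing.
have I : mu.-integrable `]0, +oo[ (EFin \o (fun x =>
    (- u * sin (u * x) - - u * sin (u * - x)) * (c / x `^ alpha))).
  have := tail_class_pairing_integrable (tail_class_cosine 0 u0).
  congr (mu.-integrable _ (EFin \o _)); apply/funext => x.
  by rewrite !addr0 sin0 !subr0.
rewrite mulrC -RintegralZl//; apply: eq_Rintegral => x _.
by rewrite !mulrN !sinD !sinN !cosN; ring.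
Qed.

Lemma smear_cosine : exists2 C, 0 <= C & forall u a b x, 0 < u -> 0 < a ->
  `|smear P X a (fun x => cos (u * x + b)) x -
    (1 + cosine_symbol (u * a)) * cos (u * x + b)| <= C * ((u * a) * (u * a) `^ beta).
Proof.
have [C C0 HC] := HX.
exists (2 * C); first by rewrite mulr_ge0.
move=> u a b x u0 a0.
have ua0 : 0 < u * a by rewrite mulr_gt0.
have := HC _ _ _ _ (tail_class_cosine (u * x + b) ua0).
rewrite stable_pairing_cosine// mulrCA mulrA => H.
apply: le_trans H; rewrite le_eqVlt; apply/orP; left; apply/eqP; congr `|_|.
have cc : continuous (fun y : R => cos (u * y + b)).
  move=> y; apply: continuous_comp; last exact: continuous_cos.
  by apply: cvgD; [apply: cvgM; [exact: cvg_cst|exact: cvg_id]|exact: cvg_cst].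
have i1 := integrable_shifted iX a x cc (fun y => normr_cos_le1 _).
have ic := integrable_cst_prob P.
have i2 : P.-integrable setT (EFin \o (fun t => (u * a * sin (u * x + b)) * X t)).
  exact: integrableZ_real.
have -> : \int[P]_t (cos (u * a * X t + (u * x + b)) - cos (u * x + b) +
      u * a * X t * sin (u * x + b)) =
    smear P X a (fun x => cos (u * x + b)) x - cos (u * x + b).
  have -> : (fun t => cos (u * a * X t + (u * x + b)) - cos (u * x + b) +
      u * a * X t * sin (u * x + b)) =
    (fun t => (cos (u * (x + a * X t) + b) - cos (u * x + b)) +
      (u * a * sin (u * x + b)) * X t).
    apply/funext => t; congr (cos _ - _ + _); first by ring.
    by rewrite mulrAC.
  rewrite RintegralD//; last exact: integrableB_real.
  by rewrite RintegralB// RintegralZl// X0 mulr0 addr0 Rintegral_cst_prob.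
by rewrite mulrDl mul1r opprD addrA.
Qed.

(** Lindeberg's replacement again, the second operator being now the
    multiplication by q = exp (J / N): one average multiplies a cosine by
    1 + J / N up to O(N^(- (1 + beta) / alpha)), and N such errors vanish in
    the limit.  Working with all phases b at once keeps everything real. *)
Lemma cvg_smeared_sum_cosine (u b : R) : 0 < u -> cosine_symbol u <= 0 ->
  smeared_sum P X alpha N (fun x => cos (u * x + b)) @[N --> \oo]
    --> expR (cosine_symbol u) * cos b.
Proof.
move=> u0 J0; have [C C0 HC] := smear_cosine.
set J := cosine_symbol u.
pose kappa := (alpha - (1 + beta)) / alpha.
have bound N : (0 < N)%N ->
  `|expR J * cos b - smeared_sum P X alpha N (fun x => cos (u * x + b))| <=
     C * (u * u `^ beta) * N%:R `^ kappa + J ^+ 2 * N%:R^-1.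
  move=> N0; have N0' : (0 : R) < N%:R by rewrite ltr0n.
  set a := scale_step alpha N; have a0 : 0 < a by exact: scale_step_gt0.
  set q := expR (J / N%:R).
  have Ja : cosine_symbol (u * a) = J / N%:R.
    rewrite cosine_symbol_scale// mulrC; congr (_ * _).
    by rewrite /a /scale_step -powRrM mulNr mulVf ?gt_eqF// powRN powRr1// ltW.
  have JN : J / N%:R <= 0 by rewrite pmulr_lle0 ?invr_gt0.
  have q0 : 0 <= q by exact: expR_ge0.
  have q1 : q <= 1 by rewrite expR_le1.
  pose e := C * ((u * a) * (u * a) `^ beta) + (J / N%:R) ^+ 2.
  have e0 : 0 <= e by rewrite addr_ge0 ?sqr_ge0// !mulr_ge0 ?powR_ge0// ltW.
  pose S f := exists s, `|s| <= 1 /\ f = (fun x : R => s * cos (u * x + b)).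
  have cosbl : bounded_lipschitz 1 u (fun x : R => cos (u * x + b)).
    split => [x|x y]; first exact: normr_cos_le1.
    apply: le_trans (cos_lipschitz _ _) _; rewrite opprD addrACA subrr addr0.
    by rewrite -mulrBr normrM (gtr0_norm u0).
  have H := @normr_iterB_le R (smear P X a) (fun f x => q * f x)
    (bounded_lipschitz 1 u) S e _ _ _ _ _ N (fun x => cos (u * x + b)) _ 0.
  have qN : iter N (fun (f : R -> R) x => q * f x) (fun x : R => cos (u * x + b)) 0
      = expR J * cos b.
    have -> : forall n x, iter n (fun (f : R -> R) x => q * f x)
         (fun x : R => cos (u * x + b)) x = q ^+ n * cos (u * x + b).
      by elim => [|n IH] x; rewrite ?mul1r// iterS IH exprS mulrA.
    rewrite mulr0 add0r; congr (_ * _).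
    by rewrite /q -expRM_natl mulrC divfK// gt_eqF.
  rewrite distrC -qN; apply: le_trans (H _ _ _ _ _ _) _.
  - by move=> f; exact: bounded_lipschitz_smear.
  - move=> f [s [s1 ->]]; exists (q * s); split.
      by rewrite normrM (ger0_norm q0) mulr_ile1.
    by apply/funext => x; rewrite mulrA.
  - move=> f [s [s1 ->]]; split => [x|x y].
      by rewrite normrM mulr_ile1// normr_cos_le1.
    rewrite -mulrBr normrM; apply: le_trans (cosbl.2 x y).
    by rewrite -[leRHS]mul1r ler_wpM2r.
  - by move=> ? f1 f2 D1 D2 D12; exact: (smear_contract iX _ D1 D2 D12).
  - move=> f [s [s1 ->]] x.
    have -> : smear P X a (fun x => s * cos (u * x + b)) x =
       s * smear P X a (fun x => cos (u * x + b)) x.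
      rewrite /smear RintegralZl//.
      apply: (integrable_shifted iX a x _ cosbl.1).
      exact: (bounded_lipschitz_continuous cosbl).
    rewrite mulrCA -mulrBr normrM; apply: (@le_trans _ _ (1 * e)); last by rewrite mul1r.
    apply: ler_pM => //.
    apply: le_trans (ler_distD ((1 + cosine_symbol (u * a)) * cos (u * x + b)) _ _) _.
    apply: lerD; first exact: HC.
    rewrite Ja -mulrBl normrM -[leRHS]mulr1 ler_pM ?normr_cos_le1//.
    exact: expR_second_order.
  - by exists 1; split; [rewrite normr1|apply/funext => x; rewrite mul1r].
  rewrite /e mulrDr; apply: lerD.
    rewrite powRM ?(ltW u0) ?(ltW a0)// -scale_step_rate// -/a.
    by rewrite le_eqVlt; apply/orP; left; apply/eqP; ring.
  by rewrite le_eqVlt; apply/orP; left; apply/eqP; field; rewrite gt_eqF.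
have kappa0 : 0 < - kappa.
  by rewrite oppr_gt0 pmulr_llt0 ?invr_gt0// subr_lt0.
have lim0 : (fun N : nat => C * (u * u `^ beta) * N%:R `^ kappa + J ^+ 2 * N%:R^-1 : R)
    @ \oo --> (0 : R).
  rewrite [X in _ --> X](_ : 0 = C * (u * u `^ beta) * 0 + J ^+ 2 * 0); last first.
    by rewrite !mulr0 addr0.
  have toinf : (fun N : nat => N%:R : R) @ \oo --> +oo by exact: cvgr_idn.
  apply: cvgD; (apply: cvgM; first exact: cvg_cst).
    have := cvg_comp _ _ toinf (cvg_powRN_pinfty kappa0).
    by rewrite opprK.
  have := cvg_comp _ _ toinf (cvg_powRN_pinfty (ltr01 : 0 < 1 :> R)).
  apply: cvg_trans; apply: near_eq_cvg; apply: nearW => N /=.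
  by rewrite powR_inv1.
apply/cvgrPdist_le => e e0; near=> N.
apply: le_trans (bound N _) _; first by near: N; exact: nbhs_infty_gt.
apply: le_trans (ler_norm _) _.
rewrite -[X in `|X|]subr0 distrC.
near: N; move/cvgrPdist_le : lim0; exact.
Unshelve. all: by end_near. Qed.

End cosine_limit.

(** * The stable exponent as a pairing *)

Section reflection.
Context {R : realType}.
Local Notation mu := (@lebesgue_measure R).

Lemma ge0_integral_oppr (f : R -> \bar R) :
  measurable_fun setT f -> (forall x, 0 <= f x)%E ->
  (\int[mu]_x f x = \int[mu]_x f (- x)%R)%E.
Proof.
move=> mf f0.
pose phi : measurableTypeR R -> measurableTypeR R := -%R.
have mphi : measurable_fun setT phi by exact: oppr_measurable.
pose nu_ : {measure set (measurableTypeR R) -> \bar R} := pushforward mu phi.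
pose nu := nu_ mphi.
transitivity (\int[nu]_x f x)%E.
  by apply: eq_measure_integral => //= A mA _; rewrite lebesgue_measureN.
by rewrite (ge0_integral_pushforward mphi).
Qed.

(** If the positive part has an infinite integral, the integral is oo - oo,
    whose real value is 0 by convention. *)
Lemma Rintegral_odd (f : R -> R) : measurable_fun setT f ->
  (forall x, f (- x) = - f x) -> \int[mu]_x f x = 0.
Proof.
move=> mf fodd; rewrite /Rintegral integralE.
have mEf : measurable_fun setT (EFin \o f) by exact/measurable_EFinP.
have -> : (\int[mu]_x (EFin \o f)^\- x = \int[mu]_x (EFin \o f)^\+ x)%E.
  rewrite (ge0_integral_oppr (measurable_funepos mEf))//.
  apply: eq_integral => x _.
  by rewrite !(funeposE, funenegE) /= fodd.
have : (0 <= \int[mu]_x (EFin \o f)^\+ x)%E by exact: integral_ge0.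
by case: (\int[mu]_x _)%E => [r||] //= _; rewrite subrr.
Qed.

End reflection.

Section stable_exponent.
Context {R : realType}.
Local Notation mu := (@lebesgue_measure R).
Variables (alpha c : R).
Hypotheses (al1 : 1 < alpha) (al2 : alpha < 2) (c0 : 0 < c).

Let al0 : 0 < alpha. Proof. exact: lt_trans al1. Qed.

Definition levy_density (x : R) : R := alpha * c / `|x| `^ (1 + alpha).

Lemma levy_density_ge0 x : 0 <= levy_density x.
Proof. by rewrite divr_ge0 ?powR_ge0// mulr_ge0// ltW. Qed.

Lemma measurable_levy_density : measurable_fun setT levy_density.
Proof.
have -> : levy_density = (fun x => (alpha * c) * `|x| `^ (- (1 + alpha))).
  by apply/funext => x; rewrite powRN.
apply: measurable_funM => //.
apply: (measurableT_comp (f := fun y : R => y `^ (- (1 + alpha)))).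
  exact: measurable_powR.
exact: normr_measurable.
Qed.

Lemma integral_levy_density_gt (x : R) : 0 < x ->
  (\int[mu]_t (levy_density t * (x < t)%R%:R)%:E = (c / x `^ alpha)%:E)%E.
Proof.
move=> x0.
transitivity (\int[mu]_(t in `]x, +oo[) (levy_density t)%:E)%E.
  rewrite [RHS]integral_mkcond; apply: eq_integral => t _.
  by rewrite /patch mem_setE in_itv/= andbT; case: (x < t); rewrite ?mulr1 ?mulr0.
transitivity (\int[mu]_(t in `[x, +oo[) ((alpha * c) * t `^ (- (1 + alpha)))%:E)%E.
  rewrite integral_itv_obnd_cbnd; last first.
    by apply/measurable_EFinP; apply: measurable_funTS; exact: measurable_levy_density.
  apply: eq_integral => t; rewrite inE/= in_itv/= andbT => xt.
  by rewrite /levy_density gtr0_norm ?powRN// (lt_le_trans x0).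
under eq_integral do rewrite EFinM.
have q1 : - (1 + alpha) < -1 by move: al0; lra.
rewrite ge0_integralZl//; last 3 first.
- by apply/measurable_EFinP; apply: measurable_funTS; exact: measurable_powR.
- by move=> t _; rewrite lee_fin powR_ge0.
- by rewrite lee_fin mulr_ge0// ltW.
rewrite integral_powR_cy// -EFinM; congr EFin.
have -> : - (1 + alpha) + 1 = - alpha by ring.
by rewrite powRN; field; rewrite !gt_eqF// powR_gt0.
Qed.

Lemma integral_levy_density_normr_gt (x : R) : 0 < x ->
  (\int[mu]_t (levy_density t * (x < `|t|)%R%:R)%:E = (2 * (c / x `^ alpha))%:E)%E.
Proof.
move=> x0.
have mw (b : R -> R) : measurable_fun setT b ->
    measurable_fun setT (fun t => (levy_density t * (x < b t)%R%:R)%:E).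
  move=> mb; apply/measurable_EFinP; apply: measurable_funM.
    exact: measurable_levy_density.
  apply: (measurableT_comp (f := fun b : bool => (b%:R : R))) => //.
  exact: measurable_fun_ltr.
transitivity (\int[mu]_t ((levy_density t * (x < t)%R%:R)%:E +
    (levy_density t * (x < - t)%R%:R)%:E))%E.
  apply: eq_integral => t _; rewrite -EFinD -mulrDr; congr (_ * _)%:E.
  rewrite lter_normr/= -natrD; congr (_%:R).
  have [xt|] := ltP x t; last by move=> _; rewrite add0n orFb.
  by rewrite ltrNr ltNge (ltW (lt_trans _ xt)) // gtrN.
rewrite ge0_integralD//; last 4 first.
- by move=> t _; rewrite lee_fin mulr_ge0// levy_density_ge0.
- exact: (mw id).
- by move=> t _; rewrite lee_fin mulr_ge0// levy_density_ge0.
- exact: (mw -%R).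
rewrite [X in (_ + X)%E]ge0_integral_oppr; last 2 first.
- exact: (mw -%R).
- by move=> t; rewrite lee_fin mulr_ge0// levy_density_ge0.
have -> : (\int[mu]_t (levy_density (- t) * (x < - - t)%R%:R)%:E =
    \int[mu]_t (levy_density t * (x < t)%R%:R)%:E)%E.
  by apply: eq_integral => t _; rewrite opprK /levy_density normrN.
rewrite integral_levy_density_gt// -EFinD; congr EFin; ring.
Qed.

(** The layer-cake formula for |t| under the Lévy density, whose tail is
    2 c / x^alpha.  Here the Hölder exponent can be taken to be 1, as
    alpha < 2. *)
Lemma cosine_symbolE (u : R) : 0 < u ->
  mu.-integrable setT (EFin \o (fun t => (cos (u * t) - 1) * levy_density t)) /\
  \int[mu]_t ((cos (u * t) - 1) * levy_density t) = cosine_symbol alpha c u.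
Proof.
move=> u0.
pose phi y := cos (u * y) - 1.
pose phi' y := - u * sin (u * y).
have T : tail_class 1 (2 * (u * u `^ 1)) (u * 2) phi phi'.
  have := tail_class_cosine ltr01 (lexx 1) 0 u0.
  congr tail_class; apply/funext => y; rewrite addr0 sin0.
    by rewrite cos0 mulr0 addr0.
  by rewrite subr0.
have [phi0 dphi cphi' _ _] := T.
have ab : alpha < 1 + 1 :> R by rewrite -(natrD _ 1 1).
have E2 x : (phi' x - phi' (- x)) * (c / x `^ alpha) = phi' x * (2 * (c / x `^ alpha)).
  by rewrite /phi' mulrN sinN; ring.
have := tail_class_pairing_integrable c al1 ab T.
rewrite (_ : (fun x => (phi' x - phi' (- x)) * (c / x `^ alpha)) =
             (fun x => phi' x * (2 * (c / x `^ alpha)))); last exact/funext.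
move=> i1.
have mn : measurable_fun (setT : set (measurableTypeR R)) (fun x : R => `|x|).
  exact: normr_measurable.
have := @layer_cake R _ (measurableTypeR R) mu (fun x : R => `|x|)
  levy_density phi phi' (fun x => 2 * (c / x `^ alpha)) false mn
  (@normr_ge0 _ _) measurable_levy_density levy_density_ge0 phi0 dphi cphi'
  integral_levy_density_normr_gt i1.
have -> : (fun t : R => phi `|t| * levy_density t) =
    (fun t => (cos (u * t) - 1) * levy_density t).
  apply/funext => t; rewrite /phi; congr ((_ - _) * _).
  have [t0|t0] := leP 0 t; first by rewrite ger0_norm.
  by rewrite ltr0_norm// mulrN cosN.
move=> [i2 ->].
split => //; rewrite /cosine_symbol /stable_pairing.
by apply: eq_Rintegral => x _; rewrite -E2.
Qed.

Lemma cosine_symbol_le0 (u : R) : 0 < u -> cosine_symbol alpha c u <= 0.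
Proof.
move=> u0; have [i1 <-] := cosine_symbolE u0.
have -> : 0 = \int[mu]_t ((0 : R)) :> R.
  by rewrite /Rintegral integral0.
apply: le_Rintegral => //; first exact: integrable0.
by move=> t _; rewrite mulr_le0_ge0 ?levy_density_ge0// subr_le0 cos_le1.
Qed.

Lemma stable_exponentE (u : R) : 0 < u ->
  stable_exponent alpha c u = ((cosine_symbol alpha c u) +i* 0)%C.
Proof.
move=> u0; rewrite /stable_exponent /cintegral; congr Complex.
  have [_ <-] := cosine_symbolE u0; apply: eq_Rintegral => x _.
  by rewrite /cexp/= expR0 /levy_density; ring.
apply: etrans (Rintegral_odd (f := fun x =>
  (sin (u * x) - u * x * (`|x| <= 1)%R%:R) * levy_density x) _ _).
- by apply: eq_Rintegral => x _; rewrite /cexp/= expR0 /levy_density; ring.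
- apply: measurable_funM; last exact: measurable_levy_density.
  apply: measurable_funB.
    apply: measurableT_comp; last exact: measurable_funM.
    by apply: continuous_measurable_fun; exact: continuous_sin.
  apply: measurable_funM; first exact: measurable_funM.
  apply: (measurableT_comp (f := fun b : bool => (b%:R : R))) => //.
  by apply: measurable_fun_ler => //; exact: normr_measurable.
- move=> x; rewrite mulrN sinN normrN /levy_density normrN; ring.
Qed.

Lemma symmetric_stable_cosine (d : measure_display) (T : measurableType d)
    (Q : probability T R) (theta : {RV Q >-> R}) (u b : R) : 0 < u ->
  symmetric_stable alpha c theta ->
  \int[Q]_t cos (u * theta t + b) = expR (cosine_symbol alpha c u) * cos b.
Proof.
move=> u0 [_ /(_ u)]; rewrite stable_exponentE// /char_fun /cintegral /cexp /=.
rewrite cos0 sin0 mulr1 mulr0 expR0 => -[Ec Es].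
have mth : measurable_fun setT (fun t => u * theta t).
  by apply: measurable_funM.
have ic := integrable_cst_prob Q.
have i1 : Q.-integrable setT (EFin \o (fun t => cos (u * theta t))).
  apply: (@integrable_le _ _ _ Q _ _ (fun=> 1)) => //; last by move=> *; exact: normr_cos_le1.
  by apply: measurableT_comp mth; apply: continuous_measurable_fun; exact: continuous_cos.
have i2 : Q.-integrable setT (EFin \o (fun t => sin (u * theta t))).
  apply: (@integrable_le _ _ _ Q _ _ (fun=> 1)) => //; last by move=> *; exact: normr_sin_le1.
  by apply: measurableT_comp mth; apply: continuous_measurable_fun; exact: continuous_sin.
under eq_Rintegral do rewrite cosD mulrC (mulrC (sin _)).
rewrite RintegralB//; [|exact: integrableZ_real..].
rewrite !RintegralZl//.
under eq_Rintegral do rewrite -[cos _]mul1r.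
rewrite Ec.
under eq_Rintegral do rewrite -[sin _]mul1r.
by rewrite Es mulr0 subr0 mulrC.
Qed.

End stable_exponent.

(** * Convergence and exchange of real-valued integrals *)

Section real_integral_theorems.
Context {R : realType} {d : measure_display} {T : measurableType d}.

Lemma EFin_Rintegral (m : {measure set T -> \bar R}) (D : set T) (f : T -> R) :
  measurable D -> m.-integrable D (EFin \o f) ->
  (\int[m]_(x in D) f x)%:E = (\int[m]_(x in D) (f x)%:E)%E.
Proof. by move=> mD i; rewrite fineK//; exact: integrable_fin_num. Qed.

Lemma cvg_Rintegral_dominated (m : {measure set T -> \bar R}) (D : set T)
    (f_ : nat -> T -> R) (f w : T -> R) : measurable D ->
  (forall n, measurable_fun D (f_ n)) ->
  (forall x, D x -> f_ n x @[n --> \oo] --> f x) ->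
  m.-integrable D (EFin \o w) -> (forall n x, D x -> `|f_ n x| <= w x) ->
  \int[m]_(x in D) f_ n x @[n --> \oo] --> \int[m]_(x in D) f x.
Proof.
move=> mD mf ff iw fw.
have := @dominated_cvg _ _ _ m D mD (fun n => EFin \o f_ n) (EFin \o f) (EFin \o w).
have mEf n : measurable_fun D (EFin \o f_ n) by exact/measurable_EFinP.
have mlim : measurable_fun D f by exact: (measurable_fun_cvg mf ff).
have fw' x : D x -> `|f x| <= w x.
  move=> Dx; have H := cvg_norm (ff x Dx).
  by apply: (cvgr_to_le (H _)); apply: nearW => n; exact: fw.
have ilim : m.-integrable D (EFin \o f) by exact: (integrable_le mD mlim fw' iw).
move=> H; apply: fine_cvg; rewrite -/(Rintegral _ _ _) EFin_Rintegral//.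
apply: H => //.
by move=> x Dx; apply: cvg_EFin; [exact: nearW|exact: ff].
Qed.

(** |g_n - g| = (g_n - g) + 2 max (g - g_n, 0): the first term has integral 0
    and the second one is dominated by g. *)
Lemma scheffe (m : {measure set T -> \bar R}) (g_ : nat -> T -> R) (g : T -> R) :
  (forall n, m.-integrable setT (EFin \o g_ n)) -> m.-integrable setT (EFin \o g) ->
  (forall n x, 0 <= g_ n x) -> (forall x, 0 <= g x) ->
  (forall n, \int[m]_x g_ n x = \int[m]_x g x) ->
  (forall x, g_ n x @[n --> \oo] --> g x) ->
  \int[m]_x `|g_ n x - g x| @[n --> \oo] --> (0 : R).
Proof.
move=> ig_ ig g_0 g0 gE gg.
have mg_ n : measurable_fun setT (g_ n) by apply/measurable_EFinP; case/integrableP: (ig_ n).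
have mg : measurable_fun setT g by apply/measurable_EFinP; case/integrableP: ig.
pose p n x := Num.max (g x - g_ n x) 0.
have mp n : measurable_fun setT (p n).
  by apply: measurable_maxr => //; exact: measurable_funB.
have pg n x : `|p n x| <= g x.
  rewrite /p ger0_norm ?le_max ?lexx ?orbT// ge_max g0 andbT.
  by rewrite gerBl.
have ip n : m.-integrable setT (EFin \o p n).
  by apply: (@integrable_le _ _ _ m _ _ g) => // x _; exact: pg.
have -> : (fun n => \int[m]_x `|g_ n x - g x|) = (fun n => 2 * \int[m]_x p n x).
  apply/funext => n.
  have -> : (fun x => `|g_ n x - g x|) = (fun x => (g_ n x - g x) + 2 * p n x).
    apply/funext => x; rewrite /p; have [h|h] := leP (g x - g_ n x) 0.
      by rewrite mulr0 addr0 ger0_norm// -oppr_le0 opprB.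
    by rewrite distrC gtr0_norm//; ring.
  rewrite RintegralD//; [|exact: integrableB_real|exact: integrableZ_real].
  by rewrite RintegralB// gE subrr add0r RintegralZl.
rewrite -[X in _ --> X](mulr0 2); apply: cvgM; first exact: cvg_cst.
have -> : 0 = \int[m]_x (0 : R) by rewrite /Rintegral integral0.
apply: (cvg_Rintegral_dominated (w := g)) => // x _.
apply/cvgrPdist_le => e e0; near=> n.
rewrite sub0r normrN (@le_trans _ _ `|g x - g_ n x|)//.
  by rewrite /p; have [h|h] := leP (g x - g_ n x) 0; rewrite ?normr0.
by near: n; have /cvgrPdist_le := gg x; exact.
Unshelve. all: by end_near. Qed.

End real_integral_theorems.

(** Fubini's theorem for a kernel F that is bounded in t for each u and whose
    integral over u is bounded uniformly in t; translates of a fixed density are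
    of this kind, although they have no common integrable majorant in u. *)
Section fubini_prob.
Context {R : realType} {d d' : measure_display} {T : measurableType d}
  {U : measurableType d'}.
Variables (P : probability T R) (m : {sigma_finite_measure set U -> \bar R}).
Variables (F : U * T -> R) (B : R) (B' : U -> R).
Hypotheses (mF : measurable_fun setT F)
  (FB : forall t, (\int[m]_u (`|F (u, t)|)%:E <= B%:E)%E)
  (FB' : forall u t, `|F (u, t)| <= B' u).

Let mEF : measurable_fun setT (EFin \o F).
Proof. exact/measurable_EFinP. Qed.

Let iF : (m \x P)%E.-integrable setT (EFin \o F).
Proof.
apply/integrable21ltyP => //.
apply: (@le_lt_trans _ _ (\int[P]_t B%:E)%E).
  apply: ge0_le_integral => //.
  - by move=> t _; exact: integral_ge0.
  - apply: (@measurable_fun_fubini_tonelli_G _ _ _ _ R m (abse \o (EFin \o F))).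
      exact: measurableT_comp.
    by move=> z; exact: abse_ge0.
  - by move=> t _; exact: FB.
have : P.-integrable setT (EFin \o (fun=> B)) by exact: finite_measure_integrable_cst.
move=> /(integrable_fin_num measurableT); rewrite fin_numElt => /andP[_].
exact.
Qed.

Let iFt t : m.-integrable setT (EFin \o (fun u => F (u, t))).
Proof.
apply/integrableP; split; first by apply: measurableT_comp mEF _.
by apply: le_lt_trans (FB t) _; rewrite ltry.
Qed.

Let iFu u : P.-integrable setT (EFin \o (fun t => F (u, t))).
Proof.
apply: (@integrable_le _ _ _ P _ _ (fun=> B' u)) => //.
- by apply: measurableT_comp mF _.
- exact: finite_measure_integrable_cst.
Qed.

Lemma integrable_Rintegral_prob :
  m.-integrable setT (EFin \o (fun u => \int[P]_t F (u, t))).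
Proof.
have := integrable_fubini_F iF; congr (m.-integrable _ _).
by apply/funext => u /=; rewrite EFin_Rintegral.
Qed.

Lemma Rintegral_swap_prob :
  \int[m]_u \int[P]_t F (u, t) = \int[P]_t \int[m]_u F (u, t).
Proof.
rewrite {1}/Rintegral [in RHS]/Rintegral; congr fine.
under eq_integral do rewrite EFin_Rintegral//.
under [in RHS]eq_integral do rewrite EFin_Rintegral//.
exact: (Fubini iF).
Qed.

Lemma measurable_Rintegral_base :
  measurable_fun setT (fun t => \int[m]_u F (u, t)).
Proof.
apply/measurable_EFinP; have := measurable_fubini_G iF.
congr (measurable_fun _ _).
by apply/funext => t /=; rewrite EFin_Rintegral.
Qed.

End fubini_prob.

(** * The Cauchy kernel *)

Section cauchy_kernel.
Context {R : realType}.
Local Notation mu := (@lebesgue_measure R).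

Definition cauchy_kernel (s z : R) : R := s / (s ^+ 2 + z ^+ 2).

Lemma cauchy_denom_gt0 (s z : R) : 0 < s -> 0 < s ^+ 2 + z ^+ 2.
Proof. by move=> s0; rewrite ltr_pwDl ?sqr_ge0// exprn_gt0. Qed.

Lemma cauchy_kernel_ge0 (s z : R) : 0 < s -> 0 <= cauchy_kernel s z.
Proof. by move=> s0; rewrite divr_ge0 ?(ltW s0)// ltW// cauchy_denom_gt0. Qed.

Lemma cauchy_kernel_le (s z : R) : 0 < s -> cauchy_kernel s z <= s^-1.
Proof.
move=> s0; rewrite /cauchy_kernel ler_pdivrMr ?cauchy_denom_gt0//.
rewrite mulrC -ler_pdivrMr ?invr_gt0//.
by rewrite invrK -expr2 lerDl sqr_ge0.
Qed.

Lemma continuous_cauchy_kernel (s : R) : 0 < s -> continuous (cauchy_kernel s).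
Proof.
move=> s0 z; apply: cvgM; first exact: cvg_cst.
apply: cvgV; first by rewrite gt_eqF// cauchy_denom_gt0.
by apply: cvgD; [exact: cvg_cst|exact: exprn_continuous].
Qed.

Lemma measurable_cauchy_kernel (s : R) : 0 < s -> measurable_fun setT (cauchy_kernel s).
Proof. by move=> s0; apply: continuous_measurable_fun; exact: continuous_cauchy_kernel. Qed.

Lemma cauchy_kernel_scale (s z : R) : 0 < s -> s * cauchy_kernel s (s * z) = cauchy_kernel 1 z.
Proof.
move=> s0; rewrite /cauchy_kernel.
have := cauchy_denom_gt0 z ltr01; rewrite expr1n => h.
have -> : s ^+ 2 + (s * z) ^+ 2 = s ^+ 2 * (1 + z ^+ 2) by ring.
field.
by rewrite (gt_eqF h) (gt_eqF s0).
Qed.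

Lemma integral_cauchy_kernel1 : (\int[mu]_z (cauchy_kernel 1 z)%:E = pi%:E)%E.
Proof.
rewrite ge0_symfun_integralT.
- rewrite -set_itvcy//.
  have -> : (\int[mu]_(x in `[0%R, +oo[) (cauchy_kernel 1 x)%:E =
     \int[mu]_(x in `[0%R, +oo[) (oneDsqr x)^-1%:E)%E.
    by apply: eq_integral => x _; rewrite /cauchy_kernel expr1n mul1r.
  by rewrite integral0y_oneDsqr -EFinM; congr EFin; field.
- by move=> x; exact: cauchy_kernel_ge0.
- exact: continuous_cauchy_kernel.
- by move=> x; rewrite /cauchy_kernel/= sqrrN.
Qed.

Lemma integral_cauchy_kernel (s x : R) : 0 < s ->
  (\int[mu]_z (cauchy_kernel s (z - x))%:E = pi%:E)%E.
Proof.
move=> s0; rewrite (ge0_integral_affine x s0); last 2 first.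
- apply/measurable_EFinP; apply: (measurableT_comp (measurable_cauchy_kernel s0)).
  exact: measurable_funB.
- by move=> z; rewrite lee_fin cauchy_kernel_ge0.
rewrite -ge0_integralZl ?lee_fin ?(ltW s0)//; last 2 first.
- apply/measurable_EFinP; apply: (measurableT_comp (measurable_cauchy_kernel s0)).
  by apply: measurable_funB => //; exact: measurable_affine.
- by move=> z _; rewrite lee_fin cauchy_kernel_ge0.
rewrite -integral_cauchy_kernel1; apply: eq_integral => z _.
by rewrite addrK -EFinM cauchy_kernel_scale.
Qed.

Lemma integrable_cauchy_kernel (s x : R) : 0 < s ->
  mu.-integrable setT (EFin \o (fun z => cauchy_kernel s (z - x))).
Proof.
move=> s0; apply/integrableP; split.
  apply/measurable_EFinP; apply: (measurableT_comp (measurable_cauchy_kernel s0)).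
  exact: measurable_funB.
under eq_integral do rewrite /= ger0_norm ?cauchy_kernel_ge0//.
by rewrite integral_cauchy_kernel// ltry.
Qed.

Lemma cvg_expRNM_pinfty (s : R) : 0 < s -> expR (- (s * u)) @[u --> +oo] --> (0 : R).
Proof.
move=> s0.
have H : (fun u : R => s * u) u @[u --> +oo] --> +oo.
  by apply: gt0_cvgMry => //; exact: cvg_id.
exact: (cvg_comp _ (fun v : R => expR (- v)) H (@cvgr_expR R)).
Qed.

Lemma integral_expRNM (s : R) : 0 < s ->
  (\int[mu]_(u in `]0%R, +oo[) (expR (- (s * u)))%:E = (s^-1)%:E)%E.
Proof.
move=> s0.
have D (x : R) : is_derive x 1 (fun u => - s^-1 * expR (- (s * u))) (expR (- (s * x))).
  by apply: is_derive_eq; rewrite /GRing.scale /=; field; rewrite gt_eqF.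
have cE : continuous (fun u : R => expR (- (s * u))).
  move=> x; apply: continuous_comp; last exact: continuous_expR.
  by apply: cvgN; apply: cvgM; [exact: cvg_cst|exact: cvg_id].
rewrite integral_itv_obnd_cbnd; last first.
  apply/measurable_EFinP; apply: measurable_funTS; exact: continuous_measurable_fun.
rewrite (@ge0_continuous_FTC2y _ _ (fun u => - s^-1 * expR (- (s * u))) 0 0).
- by rewrite mulr0 oppr0 expR0 mulr1 sub0e -EFinN opprK.
- by move=> x _; exact: expR_ge0.
- exact: continuous_subspaceT.
- rewrite -[X in _ --> X](mulr0 (- s^-1)); apply: cvgM; first exact: cvg_cst.
  exact: cvg_expRNM_pinfty.
- by move=> x _; exact: ex_derive.
- by apply: cvg_at_right_filter; exact: (is_derive_continuous D).
- by move=> x _; rewrite derive1E derive_val.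
Qed.

Lemma integrable_expRNM (s : R) : 0 < s ->
  mu.-integrable `]0, +oo[ (EFin \o (fun u => expR (- (s * u)))).
Proof.
move=> s0; apply/integrableP; split.
  apply/measurable_EFinP; apply: measurable_funTS; apply: continuous_measurable_fun => x.
  apply: continuous_comp; last exact: continuous_expR.
  by apply: cvgN; apply: cvgM; [exact: cvg_cst|exact: cvg_id].
under eq_integral do rewrite /= ger0_norm ?expR_ge0//.
by rewrite integral_expRNM// ltry.
Qed.

(** The primitive is explicit, but the fundamental theorem of calculus on a
    half-line is used for nonnegative integrands: cos (u z) is written as
    (1 + cos (u z)) - 1. *)
Lemma cauchy_kernel_laplace (s z : R) : 0 < s ->
  \int[mu]_(u in `]0, +oo[) (expR (- (s * u)) * cos (u * z)) = cauchy_kernel s z.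
Proof.
move=> s0; have dn := cauchy_denom_gt0 z s0.
pose F u := expR (- (s * u)) * (z * sin (u * z) - s * cos (u * z)) / (s ^+ 2 + z ^+ 2)
  - s^-1 * expR (- (s * u)).
pose f u := expR (- (s * u)) * cos (u * z) + expR (- (s * u)).
have D (x : R) : is_derive x 1 F (f x).
  rewrite /F /f.
  apply: is_derive_eq; rewrite /GRing.scale /=; field.
  by rewrite !gt_eqF.
have cE : continuous (fun u : R => expR (- (s * u))).
  move=> x; apply: continuous_comp; last exact: continuous_expR.
  by apply: cvgN; apply: cvgM; [exact: cvg_cst|exact: cvg_id].
have cC : continuous (fun u : R => expR (- (s * u)) * cos (u * z)).
  move=> x; apply: cvgM; first exact: cE.
  apply: continuous_comp; last exact: continuous_cos.
  by apply: cvgM; [exact: cvg_id|exact: cvg_cst].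
have cf : continuous f by move=> x; apply: cvgD; [exact: cC|exact: cE].
have f0 x : 0 <= f x.
  have -> : f x = expR (- (s * x)) * (1 + cos (x * z)) by rewrite /f; ring.
  by rewrite mulr_ge0 ?expR_ge0//; have := cos_geN1 (x * z); lra.
have If : (\int[mu]_(u in `]0%R, +oo[) (f u)%:E = (cauchy_kernel s z + s^-1)%:E)%E.
  rewrite integral_itv_obnd_cbnd; last first.
    apply/measurable_EFinP; apply: measurable_funTS; exact: continuous_measurable_fun.
  rewrite (@ge0_continuous_FTC2y _ _ F 0 0)//.
  - rewrite sub0e -EFinN; congr EFin; rewrite /F /cauchy_kernel.
    rewrite mulr0 mul0r oppr0 expR0 sin0 cos0; field.
    by rewrite !gt_eqF.
  - exact: continuous_subspaceT.
  - have H := cvg_expRNM_pinfty s0.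
    apply/cvgrPdist_le => e e0.
    pose A := (`|z| + s) / (s ^+ 2 + z ^+ 2) + s^-1.
    have A0 : 0 < A.
      apply: ltr_wpDl; last by rewrite invr_gt0.
      by apply: divr_ge0; [apply: addr_ge0 => //; exact: ltW|exact: ltW].
    near=> u.
    have Eu : `|expR (- (s * u))| <= e / A.
      rewrite -[X in `|X|]subr0 distrC; near: u.
      by move/cvgrPdist_le : H; apply; rewrite divr_gt0.
    rewrite sub0r normrN.
    apply: (@le_trans _ _ (`|expR (- (s * u))| * A)); last first.
      by rewrite -ler_pdivlMr.
    rewrite /F /A [leRHS]mulrDr; apply: le_trans (ler_normB _ _) _.
    apply: lerD; last by rewrite normrM mulrC (_ : `|s^-1| = s^-1)// gtr0_norm// invr_gt0.
    rewrite !normrM normfV (gtr0_norm dn) -mulrA ler_wpM2l// ler_wpM2r ?invr_ge0 ?(ltW dn)//.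
    apply: le_trans (ler_normB _ _) _; apply: lerD.
      by rewrite normrM -[leRHS]mulr1 ler_wpM2l// ler_norml sin_geN1 sin_le1.
    rewrite normrM (gtr0_norm s0) -[leRHS]mulr1 ler_wpM2l ?(ltW s0)//.
    by rewrite ler_norml cos_geN1 cos_le1.
  - by apply: cvg_at_right_filter; exact: (is_derive_continuous D).
  - by move=> x _; rewrite derive1E; have [] := D x.
have if_ : mu.-integrable `]0, +oo[ (EFin \o f).
  apply/integrableP; split.
    apply/measurable_EFinP; apply: measurable_funTS; exact: continuous_measurable_fun.
  under eq_integral do rewrite /= ger0_norm//.
  by rewrite If ltry.
have -> : (fun u => expR (- (s * u)) * cos (u * z)) = (fun u => f u - expR (- (s * u))).
  by apply/funext => u; rewrite /f addrK.
rewrite RintegralB//; last exact: integrable_expRNM.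
by rewrite /Rintegral If integral_expRNM//= addrK.
Unshelve. all: by end_near. Qed.

End cauchy_kernel.

(** * Smoothed densities *)

Section smoothed_density.
Context {R : realType} {d : measure_display} {T : measurableType d}.
Local Notation mu := (@lebesgue_measure R).
Variables (P : probability T R) (X : T -> R).
Hypothesis mX : measurable_fun setT X.

(** pi times the density of X + s Z, for an independent Cauchy variable Z. *)
Definition smoothed_density (s y : R) : R := \int[P]_t cauchy_kernel s (y - X t).

(** This is how the smoothed density depends on the law of X through its
    cosine transform alone. *)
Lemma smoothed_density_laplace (s y : R) : 0 < s ->
  smoothed_density s y = \int[mu]_(u in `]0, +oo[)
    (expR (- (s * u)) * \int[P]_t cos (u * X t + - (u * y))).
Proof.
move=> s0.
pose D : set (measurableTypeR R) := `]0, +oo[%classic.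
pose w : R -> R := fun u => expR (- (s * u)).
pose F (z : measurableTypeR R * T) : R := (w \_ D) z.1 * cos (z.1 * (y - X z.2)).
have w0 u : 0 <= (w \_ D) u.
  by rewrite /patch; case: ifPn => // _; exact: expR_ge0.
have w1 u : (w \_ D) u <= 1.
  rewrite /patch; case: ifPn => // uD; rewrite expR_le1 oppr_le0 mulr_ge0// ?(ltW s0)//.
  by move: uD; rewrite inE /D/= in_itv/= andbT => /ltW.
have mw : measurable_fun setT (w \_ D).
  apply/(measurable_restrictT _ _).1; first exact: measurable_itv.
  apply: measurable_funTS; apply: continuous_measurable_fun => x.
  apply: continuous_comp; last exact: continuous_expR.
  by apply: cvgN; apply: cvgM; [exact: cvg_cst|exact: cvg_id].
have mF : measurable_fun setT F.
  apply: measurable_funM; first exact: (measurableT_comp mw).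
  apply: (measurableT_comp (f := cos)).
    by apply: continuous_measurable_fun; exact: continuous_cos.
  apply: measurable_funM => //; apply: measurable_funB => //.
  exact: (measurableT_comp mX).
have FB t : (\int[mu]_u (`|F (u, t)|)%:E <= (s^-1)%:E)%E.
  rewrite -(integral_expRNM s0) [leRHS]integral_mkcond.
  apply: ge0_le_integral => //.
  - apply/measurable_EFinP; apply: measurableT_comp => //.
    by apply: (measurableT_comp mF); exact: pair2_measurable.
  - have -> : ((fun u => (expR (- (s * u)))%:E) \_ `]0%R, +oo[%classic) = EFin \o (w \_ D).
      by apply/funext => u; rewrite /patch /=; case: ifPn.
    exact/measurable_EFinP.
  - move=> u _; rewrite /F/= normrM (ger0_norm (w0 u)).
    apply: (@le_trans _ _ (((w \_ D) u)%:E)).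
      by rewrite lee_fin -[leRHS]mulr1 ler_wpM2l// normr_cos_le1.
    by rewrite /patch; case: ifPn.
have FB' u t : `|F (u, t)| <= 1.
  rewrite /F/= normrM -[leRHS]mulr1 ler_pM// ?normr_cos_le1//.
  by rewrite ger0_norm.
have := @Rintegral_swap_prob R _ _ _ _ P mu F _ (fun=> 1) mF FB FB'.
rewrite /smoothed_density => H.
transitivity (\int[P]_t \int[mu]_u F (u, t)).
  apply: eq_Rintegral => t _; rewrite -(cauchy_kernel_laplace _ s0) Rintegral_mkcond.
  apply: eq_Rintegral => u _; rewrite /F /patch/=; case: ifPn => //.
  by rewrite mul0r.
rewrite -H [RHS]Rintegral_mkcond; apply: eq_Rintegral => u _.
rewrite /patch; case: ifPn => uD; last first.
  by rewrite /F /patch/= (negbTE uD); under eq_Rintegral do rewrite mul0r;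
     rewrite Rintegral_cst_prob.
have mc : measurable_fun setT (fun t => cos (u * (y - X t))).
  apply: (measurableT_comp (f := cos)).
    by apply: continuous_measurable_fun; exact: continuous_cos.
  by apply: measurable_funM => //; exact: measurable_funB.
transitivity (w u * \int[P]_t cos (u * (y - X t))).
  rewrite -RintegralZl//; last first.
    apply: (@integrable_le _ _ _ P _ _ (fun=> 1)) => //.
      by move=> t _; exact: normr_cos_le1.
    exact: integrable_cst_prob.
  by apply: eq_Rintegral => t _; rewrite /F /patch/= uD.
congr (_ * _); apply: eq_Rintegral => t _.
by rewrite -[LHS]cosN; congr cos; ring.
Qed.

Section against_function.
Variables (s M : R) (f : R -> R).
Hypotheses (s0 : 0 < s) (mf : measurable_fun setT f) (fM : forall x, `|f x| <= M).

Let M0 : 0 <= M. Proof. by have := fM 0; exact: le_trans. Qed.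

Let F (z : measurableTypeR R * T) : R := f z.1 * cauchy_kernel s (z.1 - X z.2).

Let mF : measurable_fun setT F.
Proof.
apply: measurable_funM; first exact: (measurableT_comp mf).
apply: (measurableT_comp (measurable_cauchy_kernel s0)).
apply: measurable_funB => //.
exact: (measurableT_comp mX).
Qed.

Let FB t : (\int[mu]_u (`|F (u, t)|)%:E <= (M * pi)%:E)%E.
Proof.
rewrite EFinM -(integral_cauchy_kernel (X t) s0) -ge0_integralZl ?lee_fin ?M0//; last 2 first.
- by apply/measurable_EFinP; apply: (measurableT_comp (measurable_cauchy_kernel s0));
    exact: measurable_funB.
- by move=> u _; rewrite lee_fin cauchy_kernel_ge0.
apply: ge0_le_integral => //.
- apply/measurable_EFinP; apply: measurableT_comp => //.
  by apply: (measurableT_comp mF); exact: pair2_measurable.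
- under eq_fun do rewrite -EFinM; apply/measurable_EFinP; apply: measurable_funM => //.
  by apply: (measurableT_comp (measurable_cauchy_kernel s0)); exact: measurable_funB.
- move=> u _; rewrite -EFinM lee_fin /F/= normrM (ger0_norm (cauchy_kernel_ge0 _ s0)).
  by rewrite ler_wpM2r// cauchy_kernel_ge0.
Qed.

Let FB' u t : `|F (u, t)| <= M * s^-1.
Proof.
rewrite /F/= normrM ler_pM// ger0_norm ?cauchy_kernel_ge0//.
exact: cauchy_kernel_le.
Qed.

Let FE u : \int[P]_t F (u, t) = f u * smoothed_density s u.
Proof.
rewrite /smoothed_density -RintegralZl//.
apply: (@integrable_le _ _ _ P _ _ (fun=> s^-1)) => //.
- apply: (measurableT_comp (measurable_cauchy_kernel s0)).
  exact: measurable_funB.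
- by move=> t _; rewrite ger0_norm ?cauchy_kernel_ge0// cauchy_kernel_le.
- exact: integrable_cst_prob.
Qed.

Lemma integrable_against_smoothed_density :
  mu.-integrable setT (EFin \o (fun y => f y * smoothed_density s y)).
Proof.
have := @integrable_Rintegral_prob R _ _ _ _ P mu F _ (fun=> M * s^-1) mF FB FB'.
by congr (mu.-integrable _ (EFin \o _)); apply/funext => u; rewrite FE.
Qed.

Lemma Rintegral_against_smoothed_density :
  \int[mu]_y (f y * smoothed_density s y) =
  \int[P]_t \int[mu]_y (f y * cauchy_kernel s (y - X t)).
Proof.
rewrite -(@Rintegral_swap_prob R _ _ _ _ P mu F _ (fun=> M * s^-1) mF FB FB').
by apply: eq_Rintegral => u _; rewrite FE.
Qed.

Lemma measurable_kernel_average :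
  measurable_fun setT (fun t => \int[mu]_y (f y * cauchy_kernel s (y - X t))).
Proof. exact: (@measurable_Rintegral_base R _ _ _ _ P mu F _ mF FB). Qed.

End against_function.

Lemma smoothed_density_ge0 s y : 0 < s -> 0 <= smoothed_density s y.
Proof. by move=> s0; apply: Rintegral_ge0 => t _; exact: cauchy_kernel_ge0. Qed.

Lemma integrable_smoothed_density s : 0 < s ->
  mu.-integrable setT (EFin \o smoothed_density s).
Proof.
move=> s0; have := @integrable_against_smoothed_density s 1 (fun=> 1) s0 _ _.
have -> : (fun y => 1 * smoothed_density s y) = smoothed_density s.
  by apply/funext => y; rewrite mul1r.
by apply => // x; rewrite normr1.
Qed.

Lemma Rintegral_smoothed_density s : 0 < s ->
  \int[mu]_y smoothed_density s y = pi.
Proof.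
move=> s0; have := @Rintegral_against_smoothed_density s 1 (fun=> 1) s0 _ _.
have -> : (fun y => 1 * smoothed_density s y) = smoothed_density s.
  by apply/funext => y; rewrite mul1r.
move=> ->//; last by move=> x; rewrite normr1.
rewrite -[RHS](Rintegral_cst_prob P); apply: eq_Rintegral => t _.
under eq_Rintegral do rewrite mul1r.
by rewrite /Rintegral integral_cauchy_kernel.
Qed.

End smoothed_density.

(** * Continuity of the law in its cosine transform *)

Section kernel_average.
Context {R : realType}.
Local Notation mu := (@lebesgue_measure R).
Variables (M L : R) (f : R -> R).
Hypothesis fML : bounded_lipschitz M L f.

Let cf : continuous f. Proof. exact: bounded_lipschitz_continuous fML. Qed.
Let mf : measurable_fun setT f. Proof. exact: continuous_measurable_fun. Qed.
Let M0 : 0 <= M. Proof. by have := fML.1 0; exact: le_trans. Qed.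

Let mK : measurable_fun setT (cauchy_kernel (1 : R)).
Proof. exact: measurable_cauchy_kernel. Qed.

Let iK : mu.-integrable setT (EFin \o cauchy_kernel (1 : R)).
Proof.
have := integrable_cauchy_kernel 0 (ltr01 : 0 < 1 :> R).
by congr (mu.-integrable _ (EFin \o _)); apply/funext => z; rewrite subr0.
Qed.

Let L0 : 0 <= L.
Proof. by have := fML.2 1 0; rewrite subr0 normr1 mulr1; exact: le_trans. Qed.

(** A bound on |f (x + s w) - f x| averaged against the Cauchy kernel, uniform
    in x.  The kernel has no first moment, hence the truncation at 2 M. *)
Definition smoothing_error (s : R) : R :=
  \int[mu]_w (Num.min (M + M) (L * (s * `|w|)) * cauchy_kernel 1 w).

Let mmin (s : R) : measurable_fun setT (fun w : R => Num.min (M + M) (L * (s * `|w|))).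
Proof.
apply: measurable_minr => //; apply: measurable_funM => //; apply: measurable_funM => //.
Qed.

Let min_ge0 (s w : R) : 0 <= s -> 0 <= Num.min (M + M) (L * (s * `|w|)).
Proof. by move=> s0; rewrite le_min addr_ge0//= !mulr_ge0. Qed.

Let imin (s : R) : 0 <= s -> mu.-integrable setT
  (EFin \o (fun w => Num.min (M + M) (L * (s * `|w|)) * cauchy_kernel 1 w)).
Proof.
move=> s0; apply: (@integrable_le _ _ (measurableTypeR R) mu _ _
   (fun w => (M + M) * cauchy_kernel 1 w)) => //.
- apply: measurable_funM; [exact: mmin|exact: mK].
- move=> w _; rewrite normrM (ger0_norm (min_ge0 _ s0)) ger0_norm ?cauchy_kernel_ge0//.
  by rewrite ler_wpM2r ?cauchy_kernel_ge0// ge_min lexx.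
- exact: integrableZ_real.
Qed.

Lemma kernel_average_error (s x : R) : 0 < s ->
  `|\int[mu]_y (f y * cauchy_kernel s (y - x)) - pi * f x| <= smoothing_error s.
Proof.
move=> s0.
have mg : measurable_fun setT (fun y => f y * cauchy_kernel s (y - x)).
  apply: measurable_funM => //.
  apply: (measurableT_comp (measurable_cauchy_kernel s0)).
  exact: measurable_funB.
have mfx : measurable_fun setT (fun w => f (s * w + x)).
  by apply: measurableT_comp => //; exact: measurable_affine.
have mfK : measurable_fun setT (fun w => f (s * w + x) * cauchy_kernel 1 w).
  exact: measurable_funM.
have i1 : mu.-integrable setT (EFin \o (fun w => f (s * w + x) * cauchy_kernel 1 w)).
  apply: (@integrable_le _ _ (measurableTypeR R) mu _ _
    (fun w => M * cauchy_kernel 1 w)) => //.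
  - move=> w _; rewrite normrM (ger0_norm (cauchy_kernel_ge0 _ ltr01)).
    by rewrite ler_wpM2r ?cauchy_kernel_ge0//; exact: fML.1.
  - exact: integrableZ_real.
have i2 : mu.-integrable setT (EFin \o (fun w => f x * cauchy_kernel 1 w)).
  exact: integrableZ_real.
have -> : \int[mu]_y (f y * cauchy_kernel s (y - x)) =
    \int[mu]_w (f (s * w + x) * cauchy_kernel 1 w).
  rewrite (Rintegral_affine x s0 mg) -Rintegral_Zl_gt0//; last first.
    by apply: (measurableT_comp mg); exact: measurable_affine.
  apply: eq_Rintegral => w _.
  by rewrite mulrCA addrK cauchy_kernel_scale.
have -> : pi * f x = \int[mu]_w (f x * cauchy_kernel 1 w).
  rewrite RintegralZl// mulrC; congr (_ * _).
  by rewrite /Rintegral integral_cauchy_kernel1.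
rewrite -RintegralB//; apply: normr_Rintegral_le => //.
- by apply: measurable_funB => //; exact: measurable_funM.
- move=> w _; rewrite -mulrBl normrM (ger0_norm (cauchy_kernel_ge0 _ ltr01)).
  rewrite ler_wpM2r ?cauchy_kernel_ge0// le_min; apply/andP; split.
    by apply: le_trans (ler_normB _ _) _; apply: lerD; exact: fML.1.
  by apply: le_trans (fML.2 _ _) _; rewrite addrK normrM (gtr0_norm s0).
- by apply: imin; exact: ltW.
Qed.

Lemma cvg_smoothing_error :
  smoothing_error (harmonic n) @[n --> \oo] --> (0 : R).
Proof.
have -> : 0 = \int[mu]_w (0 : R) by rewrite /Rintegral integral0.
have h0 n : 0 <= harmonic n :> R by exact: harmonic_ge0.
apply: (cvg_Rintegral_dominated (T := measurableTypeR R)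
  (w := fun w => (M + M) * cauchy_kernel 1 w)) => //.
- by move=> n; apply: measurable_funM; [exact: mmin|exact: mK].
- move=> w _; rewrite -[X in _ --> X](mul0r (cauchy_kernel 1 w)).
  apply: cvgM; last exact: cvg_cst.
  apply: (@squeeze_cvgr _ _ _ _ (fun=> 0) (fun n => L * (harmonic n * `|w|))).
  + by apply: nearW => n; rewrite min_ge0//= ge_min lexx orbT.
  + exact: cvg_cst.
  + rewrite -[X in _ --> X](mulr0 L) -[X in _ * X](mul0r `|w|).
    by apply: cvgM; [exact: cvg_cst|apply: cvgM; [exact: cvg_harmonic|exact: cvg_cst]].
- exact: integrableZ_real.
- move=> n w _; rewrite normrM (ger0_norm (min_ge0 _ (h0 n))) ger0_norm ?cauchy_kernel_ge0//.
  by rewrite ler_wpM2r ?cauchy_kernel_ge0// ge_min lexx.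
Qed.

End kernel_average.

Section levy_continuity.
Context {R : realType} {d d' : measure_display} {T : measurableType d}
  {T' : measurableType d'}.
Local Notation mu := (@lebesgue_measure R).
Variables (P : probability T R) (Q : probability T' R).
Variables (X : nat -> T -> R) (Y : T' -> R).
Hypotheses (mX : forall n, measurable_fun setT (X n)) (mY : measurable_fun setT Y).
Hypothesis cvg_cos : forall u b : R, 0 < u ->
  \int[P]_t cos (u * X n t + b) @[n --> \oo] --> \int[Q]_t cos (u * Y t + b).

(** Tonelli's theorem gives measurability for the nonnegative 1 + cos. *)
Lemma measurable_cosine_transform (d0 : measure_display) (S : measurableType d0)
    (P0 : probability S R) (Z : S -> R) (y : R) : measurable_fun setT Z ->
  measurable_fun setT (fun u : R => \int[P0]_t cos (u * Z t + - (u * y))).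
Proof.
move=> mZ.
pose F (z : measurableTypeR R * S) : R := 1 + cos (z.1 * Z z.2 + - (z.1 * y)).
have mF : measurable_fun setT F.
  apply: measurable_funD => //; apply: (measurableT_comp (f := cos)).
    by apply: continuous_measurable_fun; exact: continuous_cos.
  apply: measurable_funB; last exact: measurable_funM.
  by apply: measurable_funM => //; exact: (measurableT_comp mZ).
have mEF : measurable_fun setT (EFin \o F) by exact/measurable_EFinP.
have F0 z : (0 <= (EFin \o F) z)%E.
  by rewrite lee_fin /F -lerBlDl sub0r cos_geN1.
have := measurable_fun_fubini_tonelli_F (m2 := P0) (EFin \o F) mEF F0.
rewrite /fubini_F => H.
have -> : (fun u : R => \int[P0]_t cos (u * Z t + - (u * y))) =
   (fun u => fine (\int[P0]_t (F (u, t))%:E)%E - 1).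
  apply/funext => u; rewrite /F -/(Rintegral P0 setT (fun t => 1 + cos (u * Z t + - (u * y)))).
  rewrite RintegralD//.
  - by rewrite Rintegral_cst_prob addrAC subrr add0r.
  - exact: integrable_cst_prob.
  - apply: (@integrable_le _ _ _ P0 _ _ (fun=> 1)) => //.
    + apply: (measurableT_comp (f := cos)).
        by apply: continuous_measurable_fun; exact: continuous_cos.
      by apply: measurable_funB => //; exact: measurable_funM.
    + by move=> t _; exact: normr_cos_le1.
    + exact: integrable_cst_prob.
apply: measurable_funB => //.
by apply: (measurableT_comp (f := fine)).
Qed.

Lemma cvg_smoothed_density (s y : R) : 0 < s ->
  smoothed_density P (X n) s y @[n --> \oo] --> smoothed_density Q Y s y.
Proof.
move=> s0; rewrite smoothed_density_laplace//.
under eq_fun do rewrite smoothed_density_laplace//.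
apply: (cvg_Rintegral_dominated (T := measurableTypeR R)
  (w := fun u => expR (- (s * u)))) => //.
- move=> n; apply: measurable_funTS; apply: measurable_funM.
    apply: continuous_measurable_fun => x.
    apply: continuous_comp; last exact: continuous_expR.
    by apply: cvgN; apply: cvgM; [exact: cvg_cst|exact: cvg_id].
  exact: measurable_cosine_transform.
- move=> u; rewrite /= in_itv/= andbT => u0; apply: cvgM; first exact: cvg_cst.
  exact: cvg_cos.
- exact: integrable_expRNM.
- move=> n u _; rewrite normrM (ger0_norm (expR_ge0 _)) -[leRHS]mulr1 ler_wpM2l ?expR_ge0//.
  rewrite -[leRHS](Rintegral_cst_prob P); apply: normr_Rintegral_le => //.
  - apply: (measurableT_comp (f := cos)).
      by apply: continuous_measurable_fun; exact: continuous_cos.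
    by apply: measurable_funD => //; exact: measurable_funM.
  - by move=> t _; exact: normr_cos_le1.
  - exact: integrable_cst_prob.
Qed.

Lemma smoothed_expectation_error (d0 : measure_display) (S : measurableType d0)
    (P0 : probability S R) (Z : S -> R) (M L s : R) (f : R -> R) :
  measurable_fun setT Z -> bounded_lipschitz M L f -> 0 < s ->
  `|\int[mu]_y (f y * smoothed_density P0 Z s y) - pi * \int[P0]_t f (Z t)|
    <= smoothing_error M L s.
Proof.
move=> mZ fML s0.
have cf := bounded_lipschitz_continuous fML.
have mf : measurable_fun setT f by exact: continuous_measurable_fun.
have i1 : P0.-integrable setT (EFin \o (fun t => f (Z t))).
  apply: (@integrable_le _ _ _ P0 _ _ (fun=> M)) => //.
  - exact: measurableT_comp.
  - by move=> t _; exact: fML.1.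
  - exact: integrable_cst_prob.
rewrite (Rintegral_against_smoothed_density P0 mZ s0 mf fML.1).
have i2 : P0.-integrable setT (EFin \o (fun t => pi * f (Z t))) by exact: integrableZ_real.
have mi := measurable_kernel_average P0 mZ s0 mf fML.1.
have i3 : P0.-integrable setT
    (EFin \o (fun t => \int[mu]_y (f y * cauchy_kernel s (y - Z t)))).
  apply: (@integrable_le _ _ _ P0 _ _ (fun t => smoothing_error M L s + pi * M)) => //.
  - move=> t _; have H := kernel_average_error fML (Z t) s0.
    rewrite -[X in `|X|](subrK (pi * f (Z t))); apply: le_trans (ler_normD _ _) _.
    apply: lerD => //; rewrite normrM (gtr0_norm (pi_gt0 R)) ler_wpM2l ?pi_ge0//.
    exact: fML.1.
  - exact: integrable_cst_prob.
rewrite -RintegralZl// -RintegralB//.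
rewrite -[leRHS](Rintegral_cst_prob P0); apply: normr_Rintegral_le => //.
- by apply: measurable_funB => //; apply: measurable_funM => //; exact: measurableT_comp.
- by move=> t _; exact: kernel_average_error.
- exact: integrable_cst_prob.
Qed.

(** Smoothing at scale s changes both expectations by a quantity that is small
    uniformly in n; at a fixed scale the smoothed densities converge in L^1. *)
Theorem levy_continuity (M L : R) (f : R -> R) : bounded_lipschitz M L f ->
  \int[P]_t f (X n t) @[n --> \oo] --> \int[Q]_t f (Y t).
Proof.
move=> fML; have fM := fML.1.
have cf := bounded_lipschitz_continuous fML.
have mf : measurable_fun setT f by exact: continuous_measurable_fun.
have M0 : 0 <= M by have := fM 0; exact: le_trans.
apply/cvgrPdist_le => e e0.
have pi0 := pi_gt0 R.
have e3 : 0 < e * pi / 3 by rewrite divr_gt0// mulr_gt0.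
have /cvgrPdist_le/(_ _ e3)[k _ /(_ k (leqnn k))/=] := cvg_smoothing_error fML.
rewrite sub0r normrN => errk.
set s : R := harmonic k in errk.
have s0 : 0 < s by exact: harmonic_gt0.
have := @scheffe _ _ (measurableTypeR R) mu (fun n => smoothed_density P (X n) s)
  (smoothed_density Q Y s).
move=> /(_ (fun n => integrable_smoothed_density P (mX n) s0)
  (integrable_smoothed_density Q mY s0)
  (fun n y => smoothed_density_ge0 P (X n) y s0)
  (fun y => smoothed_density_ge0 Q Y y s0)) H.
have {}H : \int[mu]_y `|smoothed_density P (X n) s y - smoothed_density Q Y s y|
    @[n --> \oo] --> (0 : R).
  apply: H; last by move=> y; exact: cvg_smoothed_density.
  by move=> n; rewrite !Rintegral_smoothed_density.
have e3M : 0 < e * pi / 3 / (1 + M) by rewrite divr_gt0// ltr_pwDl.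
near=> n.
have Hn : \int[mu]_y `|smoothed_density P (X n) s y - smoothed_density Q Y s y|
    <= e * pi / 3 / (1 + M).
  apply: le_trans (ler_norm _) _; rewrite -[X in `|X|]subr0 distrC; near: n.
  by move/cvgrPdist_le : H; apply.
have A1 := smoothed_expectation_error P (mX n) fML s0.
have A2 := smoothed_expectation_error Q mY fML s0.
have i1 := integrable_against_smoothed_density P (mX n) s0 mf fM.
have i2 := integrable_against_smoothed_density Q mY s0 mf fM.
have A3 : `|\int[mu]_y (f y * smoothed_density Q Y s y) -
    \int[mu]_y (f y * smoothed_density P (X n) s y)| <= e * pi / 3.
  rewrite distrC -RintegralB//.
  pose D y := `|smoothed_density P (X n) s y - smoothed_density Q Y s y|.
  have iD : mu.-integrable setT (EFin \o D).
    apply: (@integrable_norm _ (measurableTypeR R)).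
    apply: integrableB_real => //; exact: integrable_smoothed_density.
  apply: (@le_trans _ _ (\int[mu]_y (M * D y))).
    apply: normr_Rintegral_le => //.
    - case/integrableP: i1 => /measurable_EFinP m1 _.
      by case/integrableP: i2 => /measurable_EFinP m2 _; exact: measurable_funB.
    - by move=> y _; rewrite -mulrBr normrM ler_wpM2r.
    - exact: integrableZ_real.
  rewrite RintegralZl//; apply: le_trans (ler_wpM2l M0 Hn) _.
  rewrite mulrCA -[leRHS]mulr1 ler_wpM2l ?(ltW e3)// ler_pdivrMr ?mul1r ?ltr_pwDl//.
  by rewrite lerDr.
rewrite -(ler_pM2l pi0) -{1}(gtr0_norm pi0) -normrM mulrBr.
have {}errk := le_trans (ler_norm _) errk.
have {}A1 := le_trans A1 errk; have {}A2 := le_trans A2 errk.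
move: A1 A2 A3; rewrite !ler_norml => /andP[? ?] /andP[? ?] /andP[? ?].
by apply/andP; split; lra.
Unshelve. all: by end_near. Qed.

End levy_continuity.

(** * Sums of independent variables *)

Lemma ge0_integral_prob_le (R : realType) (d : measure_display) (T : measurableType d)
    (P : probability T R) (f : T -> \bar R) (M : R) : measurable_fun setT f ->
  (forall t, 0 <= f t)%E -> (forall t, f t <= M%:E)%E -> (\int[P]_t f t <= M%:E)%E.
Proof.
move=> mf f0 fM; rewrite -[in leRHS](Rintegral_cst_prob P M).
rewrite EFin_Rintegral//; last exact: integrable_cst_prob.
by apply: ge0_le_integral => // t _; apply: le_trans (fM t).
Qed.

Section independent_sums.
Context {R : realType} {d : measure_display} {T : measurableType d}.
Variables (P : probability T R) (V : nat -> {RV P >-> R}).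
Hypothesis indep : independent_RVs V.

(** The rectangles in the first n variables: a class stable under
    intersection which generates the sigma-algebra of the past. *)
Definition past_events (n : nat) : set (set T) :=
  [set E | exists2 A : nat -> set R, (forall k, measurable (A k)) &
    E = \big[setI/setT]_(k <- iota 0 n) (V k @^-1` A k)].

Lemma past_events_measurable n : past_events n `<=` measurable.
Proof.
move=> _ [A mA ->]; elim: (iota 0 n) => [|k s IH]; first by rewrite big_nil.
rewrite big_cons; apply: measurableI => //.
by rewrite -[X in measurable X]setTI; exact: measurable_funPT.
Qed.

Lemma setI_closed_past_events n : setI_closed (past_events n).
Proof.
move=> _ _ [A mA ->] [B mB ->]; exists (fun k => A k `&` B k).
  by move=> k; exact: measurableI.
by rewrite -big_split/=; apply: eq_bigr => k _; rewrite preimage_setI.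
Qed.

Lemma past_eventsT n : past_events n setT.
Proof.
exists (fun=> setT); first by [].
by rewrite big1// => k _; rewrite preimage_setT.
Qed.

Lemma past_events_coordinate n k (A : set R) : (k < n)%N -> measurable A ->
  past_events n (V k @^-1` A).
Proof.
move=> kn mA; exists (fun j => if j == k then A else setT).
  by move=> j; case: ifP.
rewrite (bigD1_seq k) ?iota_uniq ?mem_iota//= eqxx big1 ?setIT//.
by move=> j /negbTE ->; rewrite preimage_setT.
Qed.

(** Both sides are finite measures in E that agree on rectangles. *)
Lemma independent_past n (E : set T) (B : set R) : measurable B ->
  <<s past_events n >> E -> P (E `&` V n @^-1` B) = (P E * P (V n @^-1` B))%E.
Proof.
move=> mB sE.
have mVB : measurable (V n @^-1` B).
  by rewrite -[X in measurable X]setTI; exact: measurable_funPT.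
have PB0 : 0 <= fine (P (V n @^-1` B)) by rewrite fine_ge0.
pose m1 : {measure set T -> \bar R} := mrestr P mVB.
pose m2 : {measure set T -> \bar R} := mscale (NngNum PB0) P.
have PBE : P (V n @^-1` B) = (fine (P (V n @^-1` B)))%:E.
  by rewrite fineK// fin_num_measure.
have -> : (P E * P (V n @^-1` B) = m2 E)%E by rewrite /m2/= /mscale/= PBE muleC.
change (m1 E = m2 E).
apply: (g_sigma_algebra_measure_unique (past_events n) (past_events_measurable (n := n))
  (fun=> setT)) sE => //.
- by move=> _; exact: past_eventsT.
- by rewrite bigcup_const//; exists 0%N.
- exact: setI_closed_past_events.
- move=> _ [A mA ->]; rewrite /m1 /m2/= /mrestr/= /mscale/= -PBE.
  (* The rectangle extended by B in the coordinate n. *)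
  pose A' k := if k == n then B else A k.
  have mA' k : measurable (A' k) by rewrite /A'; case: ifP.
  have EA : \big[setI/setT]_(k <- iota 0 n) (V k @^-1` A k) =
     \big[setI/setT]_(k <- iota 0 n) (V k @^-1` A' k).
    rewrite !big_seq; apply: eq_bigr => k; rewrite mem_iota add0n => /andP[_ kn].
    by rewrite /A' ltn_eqF.
  have An : A' n = B by rewrite /A' eqxx.
  have := indep (iota_uniq 0 n.+1) mA'.
  rewrite -addn1 iotaD !big_cat/= !big_seq1 add0n An.
  by rewrite EA => ->; rewrite (indep (iota_uniq 0 n) mA') muleC.
- move=> _; rewrite /m1/= /mrestr/= setTI.
  by rewrite ltey_eq fin_num_measure.
Qed.

Variables (a : R) (m : nat -> R).

Definition weighted_sum (n : nat) (t : T) : R := \sum_(k < n) a * (V k t - m k).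

Lemma weighted_sum_past n (A : set R) : measurable A ->
  <<s past_events n >> (weighted_sum n @^-1` A).
Proof.
move=> mA.
pose S : g_sigma_algebraType (past_events n) -> R := weighted_sum n.
have mS : measurable_fun setT S.
  apply: measurable_sum => k; apply: measurable_funM => //.
  apply: measurable_funB => // _ B mB; rewrite setTI.
  by apply: sub_sigma_algebra; exact: past_events_coordinate.
by have := mS measurableT A mA; rewrite setTI.
Qed.

Lemma measurable_weighted_sum n : measurable_fun setT (weighted_sum n).
Proof.
by apply: measurable_sum => k; apply: measurable_funM => //; apply: measurable_funB.
Qed.

(** The partial sum is measurable with respect to the past, hence its joint
    law with V n is a product, and the average over V n can be taken first. *)
Lemma Rintegral_weighted_sumS n M L (F : R -> R) (x : R) :
  bounded_lipschitz M L F ->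
  \int[P]_t F (x + weighted_sum n.+1 t) =
  \int[P]_t smear P (fun w => V n w - m n) a F (x + weighted_sum n t).
Proof.
move=> FML; have cF := bounded_lipschitz_continuous FML.
have mF : measurable_fun setT F by exact: continuous_measurable_fun.
pose S : {RV P >-> R} := HB.pack (weighted_sum n)
  (isMeasurableFun.Build _ _ _ _ (weighted_sum n) (measurable_weighted_sum n)).
have mSV : measurable_fun setT (fun t => (S t, V n t)).
  by apply: measurable_fun_pair.
pose SV : {RV P >-> (R * R)%type} := HB.pack (fun t => (S t, V n t))
  (isMeasurableFun.Build _ _ _ _ (fun t => (S t, V n t)) mSV).
pose G (z : R * R) : R := F (x + z.1 + a * (z.2 - m n)).
have mG : measurable_fun setT G.
  apply: (measurableT_comp mF); apply: measurable_funD.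
    exact: measurable_funD.
  apply: measurable_funM => //; exact: measurable_funB.
have mEG : measurable_fun setT (EFin \o G) by exact/measurable_EFinP.
have iG (d0 : measure_display) (U : measurableType d0) (p : probability U R) (h : U -> R * R) :
    measurable_fun setT h -> p.-integrable setT (EFin \o (G \o h)).
  move=> mh; apply: (@integrable_le _ _ _ p _ _ (fun=> M)) => //.
  - exact: measurableT_comp.
  - by move=> t _; exact: FML.1.
  - exact: integrable_cst_prob.
have joint A : measurable A ->
    (distribution P S \x distribution P (V n))%E A = distribution P SV A.
  apply: product_measure_unique => B C mB mC.
  change (P (weighted_sum n @^-1` B `&` V n @^-1` C) =
    P (weighted_sum n @^-1` B) * P (V n @^-1` C))%E.
  by apply: independent_past => //; exact: weighted_sum_past.
have iprod : (distribution P S \x distribution P (V n))%E.-integrable setT (EFin \o G).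
  apply/integrable12ltyP => //.
  apply: (@le_lt_trans _ _ M%:E); last exact: ltry.
  have mabs : measurable_fun setT (abse \o (EFin \o G)) by exact: measurableT_comp.
  apply: ge0_integral_prob_le.
  - apply: (measurable_fun_fubini_tonelli_F (m2 := distribution P (V n))
      (abse \o (EFin \o G))) => //.
    by move=> z; exact: abse_ge0.
  - by move=> s; exact: integral_ge0.
  - move=> s; apply: ge0_integral_prob_le => //.
    + by apply: (measurableT_comp mabs); exact: pair1_measurable.
    + by move=> v; rewrite /= lee_fin; exact: FML.1.
transitivity (\int[P]_t G (SV t)).
  apply: eq_Rintegral => t _; rewrite /G /SV /S/= /weighted_sum big_ord_recr/= addrA.
  by [].
have fubini := integral12_prod_meas1 iprod.
rewrite /fubini_F in fubini.
rewrite /Rintegral; congr fine.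
have E1 := @integral_distribution _ _ _ _ _ P SV (EFin \o G) mEG (iG _ _ P SV mSV).
rewrite -[LHS]/(\int[P]_t ((EFin \o G) \o SV) t)%E -E1.
transitivity (\int[(distribution P S \x distribution P (V n))%E]_z (EFin \o G) z)%E.
  by apply: eq_measure_integral => A mA _; apply/esym/joint.
rewrite -fubini.
have mV' s : measurable_fun setT (fun v : R => G (s, v)).
  by apply: (measurableT_comp mG); exact: pair1_measurable.
have E2 s : (\int[distribution P (V n)]_v (EFin \o G) (s, v) =
    (\int[P]_w G (s, V n w))%:E)%E.
  rewrite EFin_Rintegral//; last first.
    by apply: (iG _ _ P (fun w => (s, V n w))); exact: measurable_fun_pair.
  rewrite -(@integral_distribution _ _ _ _ _ P (V n) (fun v => (G (s, v))%:E))//.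
    exact/measurable_EFinP.
  by apply: (iG _ _ P (fun w => (s, V n w))); exact: measurable_fun_pair.
transitivity (\int[distribution P S]_s (\int[P]_w G (s, V n w))%:E)%E.
  by apply: eq_integral => s _; exact: E2.
have mE2 : measurable_fun setT (fun s => (\int[P]_w G (s, V n w))%:E).
  under eq_fun do rewrite -E2.
  have := measurable_fubini_F iprod; exact.
rewrite (@integral_distribution _ _ _ _ _ P S (fun s => (\int[P]_w G (s, V n w))%:E))//.
apply: (@integrable_le _ _ _ P _ _ (fun=> M)) => //.
- apply: (measurableT_comp (f := fun s => \int[P]_w G (s, V n w))).
    exact/measurable_EFinP.
  exact: measurable_weighted_sum.
- move=> t _; rewrite -[leRHS](Rintegral_cst_prob P); apply: normr_Rintegral_le => //.
  + by apply: (measurableT_comp (mV' _)).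
  + by move=> w _; exact: FML.1.
  + exact: integrable_cst_prob.
- exact: integrable_cst_prob.
Qed.

End independent_sums.

Section iid_sums.
Context {R : realType} {d : measure_display} {T : measurableType d}.
Variables (P : probability T R) (V : nat -> {RV P >-> R}).
Hypotheses (hint : forall k, P.-integrable setT (EFin \o V k))
  (indep : independent_RVs V) (hident : identically_distributed V).

Definition centered (t : T) : R := V 0%N t - fine 'E_P[V 0%N].

Lemma expectation_identically_distributed k : ('E_P[V k] = 'E_P[V 0%N])%E.
Proof.
rewrite !expectation_def.
transitivity (\int[distribution P (V k)]_y y%:E)%E.
  by rewrite (@integral_distribution _ _ _ _ _ P (V k) EFin).
transitivity (\int[distribution P (V 0%N)]_y y%:E)%E.
  by apply: eq_measure_integral => A mA _; exact: hident.
by rewrite (@integral_distribution _ _ _ _ _ P (V 0%N) EFin).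
Qed.

Lemma integrable_centered : P.-integrable setT (EFin \o centered).
Proof. by apply: integrableB_real => //; exact: integrable_cst_prob. Qed.

Lemma Rintegral_centered : \int[P]_t centered t = 0.
Proof.
rewrite RintegralB//; last exact: integrable_cst_prob.
by rewrite Rintegral_cst_prob expectation_def subrr.
Qed.

Lemma smear_identically_distributed k a M L F :
  bounded_lipschitz M L F ->
  smear P (fun w => V k w - fine 'E_P[V k]) a F = smear P centered a F.
Proof.
move=> FML; have cF := bounded_lipschitz_continuous FML.
apply/funext => x; rewrite /smear /centered expectation_identically_distributed.
set m := fine _.
pose G v := F (x + a * (v - m)).
have mG : measurable_fun setT G.
  apply: measurableT_comp; first exact: continuous_measurable_fun.
  apply: measurable_funD => //; apply: measurable_funM => //; exact: measurable_funB.
have mEG : measurable_fun setT (EFin \o G) by exact/measurable_EFinP.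
have iG j : P.-integrable setT ((EFin \o G) \o V j).
  apply: (@integrable_le _ _ _ P _ (G \o V j) (fun=> M)) => //.
  - exact: measurableT_comp.
  - by move=> t _; exact: FML.1.
  - exact: integrable_cst_prob.
rewrite /Rintegral; congr fine.
transitivity (\int[P]_t ((EFin \o G) \o V k) t)%E => //.
transitivity (\int[P]_t ((EFin \o G) \o V 0%N) t)%E => //.
rewrite -(integral_distribution mEG (iG k)) -(integral_distribution mEG (iG 0%N)).
by apply: eq_measure_integral => A mA _; exact: hident.
Qed.

Lemma Rintegral_iid_sum n a M L F x : bounded_lipschitz M L F ->
  \int[P]_t F (x + weighted_sum V a (fun k => fine 'E_P[V k]) n t) =
  iter n (smear P centered a) F x.
Proof.
elim: n F => [|n IH] F FML.
  rewrite -[RHS](Rintegral_cst_prob P); apply: eq_Rintegral => t _.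
  by rewrite /weighted_sum big_ord0 addr0.
rewrite (Rintegral_weighted_sumS indep _ _ _ _ FML).
rewrite (smear_identically_distributed n a FML) IH -?iterSr//.
exact: (bounded_lipschitz_smear integrable_centered).
Qed.

Lemma Rintegral_normalized_sum (alpha : R) n M L F : bounded_lipschitz M L F ->
  \int[P]_t F (normalized_sum alpha V n t) = smeared_sum P centered alpha n F.
Proof.
move=> FML; rewrite /smeared_sum -(Rintegral_iid_sum n _ 0 FML).
apply: eq_Rintegral => t _; congr F.
by rewrite add0r /normalized_sum /weighted_sum mulr_sumr.
Qed.

End iid_sums.

(** * The Zolotarev bound *)

Section zolotarev_test_functions.
Context {R : realType}.

(** For 1 < r <= 2 the decomposition r = m + beta forces m = 1.  The derivative
    is bounded because f, bounded by M, has somewhere in each unit interval a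
    derivative of size at most 2 M, and the Hölder condition spreads this. *)
Lemma zolotarev_class_holder (r : R) (f : R -> R) : 1 < r -> r <= 2 ->
  zolotarev_class r f ->
  exists M G, bounded_lipschitz M G f /\ holder_derivative (r - 1) G f (f^`())%classic.
Proof.
move=> r1 r2 [m [beta [[rE b0 b1] [bf df _ fH]]]].
have m1 : m = 1%N.
  case: m rE {df fH} => [|[//|m]] rE.
    by move: r1; rewrite rE add0r ltNge b1.
  have m2 : (2 : R) <= m.+2%:R by rewrite ler_nat.
  have : 2 < r by rewrite rE (le_lt_trans m2)// ltrDl.
  by rewrite ltNge r2.
subst m; have bE : beta = r - 1 by rewrite rE addrAC subrr add0r.
subst beta.
have [M0 [_ HM]] := bf; pose M := M0 + 1.
have fM x : `|f x| <= M by apply: HM => //; rewrite ltrDl.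
have dff (x : R) : is_derive x 1 f ((f^`())%classic x).
  by apply: DeriveDef; [exact: (df 0%N)|rewrite derive1E].
have gH x y : `|(f^`())%classic x - (f^`())%classic y| <= `|x - y| `^ (r - 1) by exact: fH.
(* 2 M bounds the slope of a chord over a unit interval, and 1 the
   oscillation of the derivative there. *)
pose G := M + M + 1.
have gG x : `|(f^`())%classic x| <= G.
  have [z zx E] := mean_value x (x + 1) dff.
  rewrite addrAC subrr add0r mulr1 in E.
  rewrite addrAC subrr add0r normr1 in zx.
  rewrite -[X in `|X|](subKr ((f^`())%classic z)) opprB.
  apply: le_trans (ler_normD _ _) _; apply: lerD.
    by rewrite -E (le_trans (ler_normB _ _))// lerD.
  apply: le_trans (gH _ _) _; rewrite distrC.
  apply: (@le_trans _ _ (1 `^ (r - 1))); last by rewrite powR1.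
  by rewrite ge0_ler_powR ?nnegrE// ltW.
have hd : holder_derivative (r - 1) G f (f^`())%classic by split.
exists M, G; split => //; split => // x y.
exact: (holder_derivative_lipschitz _ _ hd).
Qed.

End zolotarev_test_functions.

Theorem theorem3p1 (R : realType)
    (d : measure_display) (T : measurableType d) (P : probability T R)
    (d' : measure_display) (T' : measurableType d') (Q : probability T' R)
    (alpha r c gamma : R)
    (theta : {RV Q >-> R}) (V : nat -> {RV P >-> R})
    (halpha1 : 1 < alpha) (halpha2 : alpha < 2)
    (hr1 : alpha < r) (hr2 : r <= 2)
    (htheta : symmetric_stable alpha c theta)
    (hint : forall k, P.-integrable setT (EFin \o V k))
    (hindep : independent_RVs V)
    (hident : identically_distributed V)
    (hattr : strong_attraction alpha c gamma (V 0%N))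
    (hgamma : r - alpha < gamma) :
  exists C : R, 0 < C /\
    forall n : nat, (0 < n)%N ->
      (zolotarev r (normalized_sum alpha V n : {RV P >-> R}) theta <=
        (C * n%:R `^ ((alpha - r) / alpha))%:E)%E.
Proof.
have r1 : 1 < r by exact: lt_trans hr1.
have c0 : 0 < c by case: htheta.
pose beta := r - 1.
have b0 : 0 < beta by rewrite subr_gt0.
have b1 : beta <= 1 by rewrite lerBlDr.
have rE : 1 + beta = r by rewrite addrC subrK.
have ab : alpha < 1 + beta by rewrite rE.
have iX := integrable_centered hint.
have X0 := Rintegral_centered hint.
have HX : stable_tails P alpha beta c (centered V).
  have [_ [K1 [x1 [K10 _ tail1]]] [K2 [x2 [K20 _ tail2]]]] := hattr.
  apply: stable_tails_shift => //; first exact: ltW.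
  apply: (@stable_tails_of_tail_bounds _ _ _ P _ alpha beta gamma c K1 x1 K2 x2) => //.
  - exact: ltW.
  - by rewrite rE.
  - exact: ltW.
have [C C0 HC] := smeared_sum_dyadic iX X0 halpha1 b0 b1 ab HX.
rewrite rE in HC.
have cvg_normalized M L f : bounded_lipschitz M L f ->
    smeared_sum P (centered V) alpha N f @[N --> \oo] --> \int[Q]_t f (theta t).
  move=> fML.
  have -> : (fun N => smeared_sum P (centered V) alpha N f) =
      (fun N => \int[P]_t f (normalized_sum alpha V N t)).
    by apply/funext => N; rewrite (Rintegral_normalized_sum hint hindep hident _ _ fML).
  apply: (levy_continuity (X := fun N => normalized_sum alpha V N)) fML => //.
  move=> u b u0; rewrite (symmetric_stable_cosine halpha1 halpha2 c0 b u0 htheta).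
  have cosbl : bounded_lipschitz 1 u (fun x : R => cos (u * x + b)).
    split => [x|x y]; first exact: normr_cos_le1.
    apply: le_trans (cos_lipschitz _ _) _; rewrite opprD addrACA subrr addr0.
    by rewrite -mulrBr normrM (gtr0_norm u0).
  have -> : (fun N => \int[P]_t cos (u * normalized_sum alpha V N t + b)) =
      (fun N => smeared_sum P (centered V) alpha N (fun x => cos (u * x + b))).
    by apply/funext => N; rewrite -(Rintegral_normalized_sum hint hindep hident _ _ cosbl).
  apply: (cvg_smeared_sum_cosine iX X0 halpha1 b0 b1 ab HX) => //.
  exact: cosine_symbol_le0.
(* C may vanish, and the constant is required to be positive. *)
exists (C + 1); split; first by rewrite ltr_wpDl.
move=> n n0; apply: ge_ereal_sup => _ [f fr <-].
have [M [G [fML fg]]] := zolotarev_class_holder r1 hr2 fr.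
have mf : measurable_fun setT f.
  by apply: continuous_measurable_fun; exact: bounded_lipschitz_continuous fML.
have E1 (d0 : measure_display) (S : measurableType d0) (P0 : probability S R) (Z : S -> R) :
    measurable_fun setT Z -> ('E_P0[f \o Z] = (\int[P0]_t f (Z t))%:E)%E.
  move=> mZ; rewrite unlock EFin_Rintegral//.
  apply: (@integrable_le _ _ _ P0 _ _ (fun=> M)) => //.
  - exact: measurableT_comp.
  - by move=> t _; exact: fML.1.
  - exact: integrable_cst_prob.
rewrite !E1// -EFinB lee_fin.
rewrite (Rintegral_normalized_sum hint hindep hident _ _ fML).
apply: (@le_trans _ _ (C * n%:R `^ ((alpha - r) / alpha))); last first.
  by rewrite ler_wpM2r ?powR_ge0// lerDl.
have pow2 : (fun j => 2 ^ j * n)%N @ \oo --> \oo.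
  apply/cvgnyPge => A; near=> j.
  apply: (@leq_trans j); first by near: j; exact: nbhs_infty_ge.
  apply: leq_trans (ltnW (ltn_expl j (ltnSn 1))) _.
  by rewrite leq_pmulr.
have lim := cvg_comp _ _ pow2 (cvg_normalized _ _ _ fML).
have lim2 := cvg_norm (cvgB (cvg_cst (smeared_sum P (centered V) alpha n f)) lim).
apply: (cvgr_to_le (lim2 _ _ _)); apply: nearW => j /=.
exact: (HC _ _ _ _ _ _ n0 fML.1 fg).
Unshelve. all: by end_near. Qed.
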